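(* Let $X$ be an uncountable compact metric space and let $n$ be a positive integer. Then the set of $f \in C_n(X)$ such that \[ \dim_{\mathrm T} f(X) = \dim_{\mathrm H} f(X) = \underline{\dim}_{\mathrm B} f(X) = \min\{n, \dim_{\mathrm T} X\} \] and \[ \dim_{\mathrm P} f(X) = \overline{\dim}_{\mathrm B} f(X) = n \] is residual in $C_n(X)$.
   Context: $C_n(X)$ is the Banach space of all continuous functions $f\colon X\to\mathbb{R}^n$ with the supremum norm $\|\cdot\|_\infty$. In a complete metric space, a set is meagre if it is a countable union of nowhere dense sets, and residual if its complement is meagre. $\dim_{\mathrm T}$ denotes topological (small inductive, equivalently Lebesgue covering) dimension, a non-negative integer or $+\infty$ for non-empty spaces. $\dim_{\mathrm H}$ denotes Hausdorff dimension. For a non-empty bounded $F\subseteq\mathbb{R}^n$, let $N_\delta(F)$ be the smallest number of open sets of diameter at most $\delta$ needed to cover $F$; then $\underline{\dim}_{\mathrm B} F$ and $\overline{\dim}_{\mathrm B} F$ are the lower and upper limits as $\delta\to 0$ of $\log N_\delta(F)/(-\log\delta)$. $\dim_{\mathrm P}$ denotes packing dimension, $\dim_{\mathrm P} F=\inf\{\sup_i \overline{\dim}_{\mathrm B} F_i : F\subseteq \bigcup_{i=1}^\infty F_i\}$ with the $F_i$ bounded (equivalently, the dimension defined by packing measures). *)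

(* Defs.v *)
From HB Require Import structures.
From mathcomp Require Import all_boot all_order all_algebra.
From mathcomp Require Import all_classical all_reals all_analysis.

Set Implicit Arguments.
Unset Strict Implicit.
Unset Printing Implicit Defensive.

Import Order.TTheory GRing.Theory Num.Theory.
Import numFieldNormedType.Exports.

Local Open Scope classical_set_scope.
Local Open Scope ring_scope.

Section Baire_category.
Variable T : topologicalType.

Definition nowhere_dense (A : set T) := (closure A)° = set0.

Definition meagre (A : set T) :=
  exists F : nat -> set T,
    (forall i, nowhere_dense (F i)) /\ A = \bigcup_i F i.

Definition residual (A : set T) := meagre (~` A).

End Baire_category.

Section covering_dimension.
Variable T : topologicalType.

(* Every finite open cover has a finite open refinement no point of which lies
   in more than k + 1 members. *)
Definition covering_dim_le (k : nat) :=
  forall (p : nat) (U : 'I_p -> set T),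
    (forall i, open (U i)) -> \bigcup_i U i = setT ->
  exists (q : nat) (V : 'I_q -> set T),
    [/\ forall j, open (V j), \bigcup_j V j = setT,
        forall j, exists i, V j `<=` U i &
        forall x, (#|[pred j | x \in V j]| <= k.+1)%N].

(* +oo when no k works; the empty space gets 0 rather than -1. *)
Definition dimT (R : realType) : \bar R :=
  ereal_inf [set k%:R%:E | k in covering_dim_le].

End covering_dimension.

Section Euclidean_space.
Variables (R : realType) (n : nat).
Implicit Types (x y : 'rV[R]_n) (F : set 'rV[R]_n).

(* The norm of the library on 'rV[R]_n is the maximum norm; it induces the same
   topology, uniformity and bounded sets. *)
Definition edist x y : R := Num.sqrt (\sum_(i < n) (x ord0 i - y ord0 i) ^+ 2).

(* The point 0 is added so that the empty set has diameter 0. *)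
Definition diam F : \bar R :=
  ereal_sup (0%E |` [set z | exists x y, [/\ F x, F y & z = (edist x y)%:E]]).

Local Open Scope ereal_scope.

Definition Hausdorff_premeasure (s d : R) F : \bar R :=
  ereal_inf [set \sum_(0 <= i <oo) (diam (U i)) `^ s | U in
    [set U : nat -> set 'rV[R]_n |
      (forall i, diam (U i) <= d%:E) /\ F `<=` \bigcup_i U i]].

Definition Hausdorff_measure (s : R) F : \bar R :=
  ereal_sup [set Hausdorff_premeasure s d F | d in [set d : R | (0 < d)%R]].

(* Leaving out s = 0 does not change the infimum and avoids 0 `^ 0 = 1. *)
Definition dimH F : \bar R :=
  ereal_inf [set s%:E | s in
    [set s : R | (0 < s)%R /\ Hausdorff_measure s F = 0]].

(* +oo if there is no finite cover, i.e. if F is unbounded. *)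
Definition cover_number (d : R) F : \bar R :=
  ereal_inf [set m%:R%:E | m in
    [set m : nat | exists U : 'I_m -> set 'rV[R]_n,
      [/\ forall i, open (U i), forall i, diam (U i) <= d%:E &
          F `<=` \bigcup_i U i]]].

Definition lower_dimB F : \bar R :=
  limf_einf (fun d : R => lne (cover_number d F) / (- ln d)%:E) 0^'+.

Definition upper_dimB F : \bar R :=
  limf_esup (fun d : R => lne (cover_number d F) / (- ln d)%:E) 0^'+.

(* Empty pieces have upper_dimB equal to -oo, so they do not affect the
   supremum. *)
Definition dimP F : \bar R :=
  ereal_inf [set ereal_sup (range (fun i => upper_dimB (F_ i))) | F_ in
    [set F_ : nat -> set 'rV[R]_n |
      (forall i, bounded_set (F_ i)) /\ F `<=` \bigcup_i F_ i]].

End Euclidean_space.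

Section continuous_functions.
Variables (R : realType) (X : topologicalType) (n : nat).

Definition Cn := continuousType X 'rV[R]_n.

Let Cn_uniform (f : Cn) : {uniform X -> 'rV[R]_n} := f.

HB.instance Definition _ := Uniform.copy Cn (initial_topology Cn_uniform).

Definition sup_dist (f g : Cn) : R := sup (range (fun x => edist (f x) (g x))).

Lemma edist_ge_coord (x y : 'rV[R]_n) i :
  `|x ord0 i - y ord0 i| <= edist x y.
Proof.
rewrite -sqrtr_sqr ler_wsqrtr// (bigD1 i)//= lerDl.
by apply: sumr_ge0 => j _; exact: sqr_ge0.
Qed.

Lemma edist_le_sum (x y : 'rV[R]_n) :
  edist x y <= \sum_(i < n) `|x ord0 i - y ord0 i|.
Proof.
set s := \sum_(i < n) _; have s0 : 0 <= s by apply: sumr_ge0.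
rewrite -[leRHS]ger0_norm// -sqrtr_sqr ler_wsqrtr// expr2 mulr_suml.
apply: ler_sum => i _; rewrite -real_normK ?num_real// expr2.
apply: ler_wpM2l => //; rewrite /s (bigD1 i)//= lerDl.
exact: sumr_ge0.
Qed.

Lemma has_sup_edist (f g : Cn) : compact [set: X] -> [set: X] !=set0 ->
  has_sup (range (fun x => edist (f x) (g x))).
Proof.
move=> cX [x0 _]; split; first by exists (edist (f x0) (g x0)), x0.
have bnd (h : Cn) : exists M, forall x i, `|h x ord0 i| <= M.
  have ch : compact (range h).
    apply: continuous_compact => //; apply: continuous_subspaceT.
    exact: cts_fun.
  have [M [_ /(_ (M + 1))]] := compact_bounded ch.
  rewrite ltrDl ltr01 => /(_ isT) hM; exists (M + 1) => x i.
  have /hM : range h (h x) by exists x.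
  apply: le_trans; rewrite [leRHS]/Num.norm/= mx_normrE.
  by apply: (le_trans _ (le_bigmax _ _ (ord0, i))).
have [M hM] := bnd f; have [N hN] := bnd g.
exists (\sum_(i < n) (M + N)) => _ [x _ <-].
apply: (le_trans (edist_le_sum _ _)); apply: ler_sum => i _.
by rewrite (le_trans (ler_normB _ _))// lerD.
Qed.

(* For compact X, the topology of Cn is that of the supremum norm. *)
Lemma Cn_nbhsP (f : Cn) (A : set Cn) : compact [set: X] ->
  nbhs f A <-> exists2 e, 0 < e & [set g | sup_dist f g < e] `<=` A.
Proof.
move=> cX; split => [[B [[W oW <-]] Wf WA]|[e e0 eA]].
  have : nbhs (Cn_uniform f) W by apply: open_nbhs_nbhs; split.
  move=> /uniform_nbhs[E [entE EW]].
  move: entE; rewrite -entourage_ballE => -[e /= e0 eE].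
  exists e => // g fg; apply: WA; apply: EW => x _ /=.
  apply: eE => /=; split => // i j; rewrite ord1 -ball_normE/=.
  apply: (le_lt_trans (edist_ge_coord _ _ j)); apply: le_lt_trans fg.
  apply: sup_upper_bound; last by exists x.
  by apply: has_sup_edist => //; exists x.
pose d := e / 2 / n.+1%:R; have d0 : 0 < d by rewrite !divr_gt0.
pose B : set {uniform X -> 'rV[R]_n} := [set g | forall x, ball (f x) d (g x)].
have fB : nbhs (Cn_uniform f) B.
  apply/uniform_nbhs; exists [set xy | ball xy.1 d xy.2]; split.
    by rewrite -entourage_ballE; exists d.
  by move=> g /= fg x; exact: fg.
have fB' : nbhs f (Cn_uniform @^-1` B) by exact: initial_continuous.
apply: filterS fB' => g /= fg.
apply: eA => /=; apply: (@le_lt_trans _ _ (e / 2)); last first.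
  by rewrite ltr_pdivrMr// ltr_pMr// ltr1n.
have [/set0P X0|/negP/negPn/eqP X0] := pselect ([set: X] != set0); last first.
  by rewrite /sup_dist X0 image_set0 sup0 divr_ge0// ltW.
apply: ge_sup; first by case: X0 => x _; exists (edist (f x) (g x)), x.
move=> _ [x _ <-]; apply: (le_trans (edist_le_sum _ _)).
apply: (@le_trans _ _ (\sum_(i < n) d)).
  apply: ler_sum => i _; have [_ /(_ ord0 i)] := fg x.
  by rewrite -ball_normE/= => /ltW.
rewrite sumr_const card_ord -[leLHS]mulr_natr -[leLHS]mulrA.
have e20 : 0 <= e / 2 by rewrite divr_ge0// ltW.
by rewrite ler_piMr// mulrC ler_pdivrMr// mul1r ler_nat.
Qed.

End continuous_functions.

(* Main.v *)
Require Import Defs.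
From HB Require Import structures.
From mathcomp Require Import all_boot all_order all_algebra.
From mathcomp Require Import all_classical all_reals all_analysis.
From mathcomp Require Import ring lra zify.
Set Implicit Arguments.
Unset Strict Implicit.
Unset Printing Implicit Defensive.
Import Order.TTheory GRing.Theory Num.Theory.
Import numFieldNormedType.Exports.
Local Open Scope classical_set_scope.
Local Open Scope ring_scope.

(* Put k = min(n, dim X).

   Upper bounds. Mapping X into the nerve of a fine cover of order k + 1 and the
   nerve into R^n, one approximates any f by maps whose image is covered by
   O(M^k) balls of radius 1/M; hence the generic f(X) has very good covers at
   arbitrarily small scales, and its lower box dimension is at most k.

   Lower bounds. A point y of R^k is a stable value of f if every map close to
   the first k coordinates of f hits y. If f has a stable value, then
   dim f(X) >= k, since otherwise these coordinates could be approximated by maps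
   through a (k-1)-dimensional nerve, which miss some point next to y. Having a
   stable value is an open condition. It is dense when dim X >= k: if no map near
   f0 has one, then any k of the coordinates of any F : X -> R^N can be made to
   avoid any given point, so F can be made to avoid all points having k
   coordinates in a lattice; then k shifted cubical grids with disjoint open cells
   give covers of X of order k, i.e. dim X < k.

   The same grid covers prove Szpilrajn's inequality dim_T <= dim_H: if
   H^(d+1)(K) = 0, then d + 1 translates of a cubical grid can be chosen one after
   the other by averaging, so that no point of K lies on all of them.

   Packing dimension. Let C be the set of condensation points of X. Generically,
   arbitrarily small pieces of C contain points whose images form nearly optimal
   n-dimensional grids. By Baire's theorem in C, one of countably many sets
   covering f(X) is dense in the image of such a piece, so that its upper box
   dimension is n. *)

(** * Norm estimates, finite nets and Lebesgue numbers *)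

Section basics.
Variable R : realType.

Lemma coord_norm_le n (x : 'rV[R]_n) i : `|x ord0 i| <= `|x|.
Proof.
rewrite [leRHS]/Num.norm/= mx_normrE.
exact: (le_trans _ (le_bigmax _ _ (ord0, i))).
Qed.

Lemma row_norm_le n (x : 'rV[R]_n) e : 0 <= e ->
  (forall i, `|x ord0 i| <= e) -> `|x| <= e.
Proof.
move=> e0 xe; rewrite [leLHS]/Num.norm/= mx_normrE.
by apply: bigmax_le => // -[i j] _; rewrite ord1.
Qed.

Lemma row_norm_lt n (x : 'rV[R]_n) e : 0 < e ->
  (forall i, `|x ord0 i| < e) -> `|x| < e.
Proof.
move=> e0 xe; rewrite [ltLHS]/Num.norm/= mx_normrE.
by apply/bigmax_ltP; split => // -[i j] _; rewrite ord1.
Qed.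

Lemma edist_norm n (x y : 'rV[R]_n) : `|x - y| <= Defs.edist x y.
Proof.
apply: row_norm_le => [|i]; first exact: sqrtr_ge0.
by rewrite !mxE; exact: edist_ge_coord.
Qed.

Lemma norm_edist n (x y : 'rV[R]_n) : Defs.edist x y <= n%:R * `|x - y|.
Proof.
apply: (le_trans (edist_le_sum _ _)).
apply: (@le_trans _ _ (\sum_(i < n) `|x - y|)); last first.
  by rewrite sumr_const card_ord mulr_natl.
by apply: ler_sum => i _; have := coord_norm_le (x - y) i; rewrite !mxE.
Qed.

Lemma continuous_row (T : topologicalType) n (f : T -> 'rV[R]_n) :
  (forall i, continuous (fun x => f x ord0 i)) -> continuous f.
Proof.
move=> cf x; apply/cvg_ballP => e e0.
have : \forall y \near x, forall i : 'I_n, `|f x ord0 i - f y ord0 i| < e.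
  apply: (@filter_forall _ _
    (fun i => [set y | `|f x ord0 i - f y ord0 i| < e])) => i.
  by have /cvg_ballP/(_ e e0) := cf i x; apply: filterS => y.
apply: filterS => y fxy; rewrite -ball_normE/=; apply: row_norm_lt => // i.
by rewrite !mxE.
Qed.

Lemma continuous_nbhs (T : topologicalType) n (f : T -> 'rV[R]_n) p e :
  continuous f -> 0 < e ->
  nbhs p [set x | `|f p - f x| < e].
Proof.
move=> cf e0; have /cvg_ballP/(_ _ e0) := cf p.
by apply: filterS => x; rewrite -ball_normE.
Qed.

Lemma continuous_coord (T : topologicalType) n (f : T -> 'rV[R]_n) i :
  continuous f -> continuous (fun x => f x ord0 i).
Proof.
move=> cf x.
exact: (continuous_comp (cf x) (@coord_continuous R 1 n ord0 i (f x))).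
Qed.

Lemma continuous_sum (T : topologicalType) (I : Type) (r : seq I)
    (f : I -> T -> R) :
  (forall i, continuous (f i)) -> continuous (fun x => \sum_(i <- r) f i x).
Proof.
move=> cf; elim: r => [|i r IH].
  by under eq_fun do rewrite big_nil; exact: cst_continuous.
under eq_fun do rewrite big_cons.
by move=> x; apply: cvgD; [exact: cf|exact: IH].
Qed.

Lemma finite_net (T : topologicalType) (U : T -> set T) :
  compact [set: T] -> (forall p, nbhs p (U p)) ->
  exists s : seq T, forall y, exists2 p, p \in s & U p y.
Proof.
move=> cT nU.
(* The filter of properties shared by all sufficiently large finite lists; the near-covering form of
   compactness yields one list that serves every [y]. *)
pose F : set_system (seq T) :=
  [set A : set (seq T) |
    exists s0 : seq T, forall s : seq T, {subset s0 <= s} -> A s].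
have FF : Filter F.
  split; first by exists [::].
    move=> A B [s As] [t Bt]; exists (s ++ t) => u stu; split.
      by apply: As => x xs; apply: stu; rewrite mem_cat xs.
    by apply: Bt => x xs; apply: stu; rewrite mem_cat xs orbT.
  by move=> A B AB [s As]; exists s => t /As /AB.
have /compact_near_coveringP/(_ _ F
  (fun s y => exists2 p, p \in s & U p y) FF) := cT.
case=> [x _|s /(_ s)/(_ (fun=> id)) sP]; last by exists s => y; exact: sP.
exists (U x, [set s : seq T | x \in s]); first split => //=.
  by exists [:: x] => s; apply; rewrite inE.
by move=> [y s] /= [Uxy xs]; exists x.
Qed.

Lemma nbhs_mdist (X : metricType R) (x : X) e : 0 < e ->
  nbhs x [set y | mdist x y < e].
Proof. by rewrite -ballEmdist; exact: nbhsx_ballx. Qed.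

Lemma continuous_mdist (X : metricType R) (p : X) : continuous (mdist p).
Proof.
move=> x; apply/cvg_ballP => e e0.
apply: filterS (nbhs_mdist x e0) => y /= xy; rewrite -ball_normE/=.
have := metric_triangle p x y; have := metric_triangle p y x.
rewrite (metric_sym y x) ltr_distl => h1 h2; apply/andP; split; lra.
Qed.

Lemma continuous_max0 (T : topologicalType) (f : T -> R) :
  continuous f -> continuous (fun x => Num.max 0 (f x)).
Proof.
move=> cf x.
exact: (@continuous_max _ _ (cst 0) f x (cvg_cst _) (cf x)).
Qed.

(* D need not be a metric of T: with D x y = |f x - f y| this applies to the
   covers of X pulled back from the image of f. *)
Lemma lebesgue_number (T : topologicalType) (D : T -> T -> R) p
    (U : 'I_p -> set T) : compact [set: T] ->
  (forall x y z, D x z <= D x y + D y z) ->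
  (forall x r, 0 < r -> nbhs x [set y | D x y < r]) ->
  (forall x, exists i, exists2 r, 0 < r & forall y, D x y < r -> U i y) ->
  exists2 d, 0 < d & forall x, exists i, forall y, D x y < d -> U i y.
Proof.
move=> cT Dtri nD UD.
pose good x r := 0 < r /\ exists i, forall y, D x y < r -> U i y.
have /choice[r rP] : forall x, exists r, good x r.
  by move=> x; have [i [r r0 Ur]] := UD x; exists r; split => //; exists i.
have r20 x : 0 < r x / 2 by rewrite divr_gt0// (rP x).1.
have [s sP] := finite_net cT (fun x => nD x _ (r20 x)).
exists (\big[Num.min/1]_(p <- s) (r p / 2)).
  by elim/big_ind : _ => // x y x0 y0; rewrite lt_min x0 y0.
move=> x; have [q qs xq] := sP x; have [_ [i iP]] := rP q.
exists i => y xy; apply: iP; apply: (le_lt_trans (Dtri q x y)).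
rewrite [r q]splitr ltrD//; apply: (lt_le_trans xy).
exact: (@ge_bigmin_seq _ _ _ s _ q xpredT _ qs).
Qed.

End basics.

(** * Covers by cubical grids *)

Section grid.
Variable R : realType.

(* The refinement consists of the open cells of m translated cubical grids:
   each point lies in at most one cell of each grid. *)
Lemma grid_cover (T : topologicalType) (N m B p : nat) (F : 'I_N -> T -> R)
    (a : 'I_m -> R) (d : R) (U : 'I_p -> set T) (t0 : T) :
  0 < d -> (forall i, continuous (F i)) ->
  (forall j i x, a j <= F i x < a j + d * B%:R) ->
  (forall x, exists j, forall i (z : 'I_B), F i x != a j + d * z%:R) ->
  (forall x, exists i, forall y, (forall l, `|F l x - F l y| < d) -> U i y) ->
  exists (q : nat) (V : 'I_q -> set T),
    [/\ forall j, open (V j), \bigcup_j V j = setT,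
        forall j, exists i, V j `<=` U i &
        forall x, (#|[pred j | x \in V j]| <= m)%N].
Proof.
move=> d0 cF Fa Fgrid FU.
pose I := ('I_m * {ffun 'I_N -> 'I_B})%type.
pose W (t : I) : set T := [set x | forall i,
  a t.1 + d * (t.2 i)%:R < F i x /\ F i x < a t.1 + d * (t.2 i).+1%:R].
exists #|{: I}|, (fun j => W (enum_val j)); split.
- move=> j; rewrite openE => x /= Wx.
  apply: (@filter_forall _ _ (fun i => [set y |
    a (enum_val j).1 + d * ((enum_val j).2 i)%:R < F i y /\
    F i y < a (enum_val j).1 + d * ((enum_val j).2 i).+1%:R])) => i.
  have [l u] := Wx i; apply: filterI.
    exact: (cvgr_gt (F i x) (cF i x) _ l).
  exact: (cvgr_lt (F i x) (cF i x) _ u).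
- apply/seteqP; split => // x _; have [j Fj] := Fgrid x.
  pose y i := (F i x - a j) / d.
  have y0 i : 0 <= y i 
    by have /andP[l _] := Fa j i x; apply: divr_ge0; [lra|exact: ltW].
  have yB i : (Num.trunc (y i) < B)%N.
    rewrite -(ltr_nat R); apply: le_lt_trans (andP (truncn_itv (y0 i))).1 _.
    by have /andP[_] := Fa j i x; rewrite /y ltr_pdivrMr// mulrC ltrBlDl.
  pose z := [ffun i => Ordinal (yB i)].
  exists (enum_rank (j, z)) => //; rewrite /W /= => i.
  rewrite enum_rankK/= ffunE/=; have /andP[lo hi] := truncn_itv (y0 i).
  have -> : F i x = a j + d * y i by rewrite /y; field; rewrite gt_eqF.
  rewrite !ltrD2l !ltr_pM2l//; split => //; rewrite lt_neqAle lo andbT.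
  apply/eqP => zy; have /eqP := Fj i (Ordinal (yB i)); apply => /=.
  by rewrite zy /y; field; rewrite gt_eqF.
- move=> j; have [[x Wx]|W0] := pselect (exists x, W (enum_val j) x).
    have [i Ui] := FU x; exists i => y Wy; apply: Ui => l.
    have [] := Wx l; have [] := Wy l; rewrite -!natr1 mulrDr mulr1 ltr_distl => *.
    by apply/andP; split; lra.
  by have [i _] := FU t0; exists i => x Wx; exfalso; apply: W0; exists x.
- move=> x; rewrite -[leqRHS]card_ord.
  rewrite -(@card_in_image _ _ (fun j => (enum_val j : I).1)); last first.
    move=> j j'; rewrite !inE => Wj Wj' eqj; apply: enum_val_inj.
    move: Wj Wj'; rewrite /W/= => Wj Wj'.
    apply: injective_projections => //; apply/ffunP => i; apply/val_inj/eqP.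
    have [l1 u1] := Wj i; have [l2 u2] := Wj' i.
    rewrite eqj in l1 u1; rewrite eqn_leq; apply/andP; split; rewrite -ltnS.
      by rewrite -(ltr_nat R) -(ltr_pM2l d0); lra.
    by rewrite -(ltr_nat R) -(ltr_pM2l d0); lra.
  exact: max_card.
Qed.

End grid.

(** * Generic maps *)

Section dense_interior.
Variables (R : realType) (X : topologicalType) (n : nat).
Implicit Types (f g h : X -> 'rV[R]_n) (O : set (X -> 'rV[R]_n)).

(* Density of the interior for uniform convergence, phrased on bare functions to
   avoid packaging every construction as an element of Cn. *)
Definition dense_interior O := forall f e, continuous f -> 0 < e ->
  exists g, [/\ continuous g, forall x, `|f x - g x| < e &
    exists2 r, 0 < r & forall h, continuous h ->
      (forall x, `|g x - h x| < r) -> O h].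

Lemma dense_interior_setT : dense_interior setT.
Proof.
move=> f e cf e0; exists f; split => // [x|]; first by rewrite subrr normr0.
by exists 1.
Qed.

Lemma dense_interiorS O O' : O `<=` O' -> dense_interior O -> dense_interior O'.
Proof.
move=> OO' dO f e cf e0; have [g [cg fg [r r0 gO]]] := dO f e cf e0.
by exists g; split => //; exists r => // h ch /(gO h ch)/OO'.
Qed.

Lemma dense_interiorI O O' : dense_interior O -> dense_interior O' ->
  dense_interior (O `&` O').
Proof.
move=> dO dO' f e cf e0; have e20 : 0 < e / 2 by rewrite divr_gt0.
have [g [cg fg [r r0 gO]]] := dO f _ cf e20.
have s0 : 0 < Num.min (e / 2) (r / 2) by rewrite lt_min e20 divr_gt0.
have [k [ck gk [r' r'0 kO']]] := dO' g _ cg s0.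
exists k; split => // [x|].
  have := gk x; rewrite lt_min => /andP[gk1 _].
  rewrite -(subrKA (g x)) (splitr e) (le_lt_trans (ler_normD _ _))//.
  exact: ltrD.
exists (Num.min (r / 2) r'); first by rewrite lt_min r'0 divr_gt0.
move=> h ch kh; split; last first.
  by apply: kO' => // x; have := kh x; rewrite lt_min => /andP[].
apply: gO => // x; have := gk x; rewrite lt_min => /andP[_ gk1].
have := kh x; rewrite lt_min => /andP[kh1 _].
rewrite -(subrKA (k x)) (splitr r) (le_lt_trans (ler_normD _ _))//.
exact: ltrD.
Qed.

Lemma dense_interior_seq (I : eqType) (s : seq I) (O : I -> set (X -> 'rV_n)) :
  (forall i, dense_interior (O i)) ->
  dense_interior [set f | forall i, i \in s -> O i f].
Proof.
move=> dO; elim: s => [|i s IH].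
  by apply: dense_interiorS dense_interior_setT => f _ i.
apply: dense_interiorS (dense_interiorI (dO i) IH) => f [Oi Os] j.
by rewrite inE => /predU1P[->|/Os].
Qed.

(** The maps violating one [O i] form a nowhere dense set: a ball in its closure would contain a map
    with a whole neighbourhood inside [O i]. *)
Lemma residual_dense_interior (A : set (Cn R X n))
    (O : nat -> set (X -> 'rV[R]_n)) : compact [set: X] ->
  (forall i, dense_interior (O i)) ->
  (forall f : Cn R X n, (forall i, O i f) -> A f) -> residual A.
Proof.
move=> cX dO OA.
have unif (f : Cn R X n) (B : set (Cn R X n)) e : 0 < e ->
    (forall g : Cn R X n, (forall x, `|f x - g x| < e) -> B g) -> nbhs f B.
  move=> e0 eB; apply/Cn_nbhsP => //; exists e => // g /= fg; apply: eB => x.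
  apply: (le_lt_trans (edist_norm _ _)); apply: le_lt_trans fg.
  apply: sup_upper_bound; last by exists x.
  by apply: has_sup_edist => //; exists x.
(* [meagre] asks for an equality, hence the intersection with the complement of [A]. *)
exists (fun i => ~` A `&` [set f : Cn R X n | ~ O i f]); split; last first.
  apply/seteqP; split => [f nAf|f [i _ []]//].
  have /existsNP[i nOi] : ~ forall i, O i f by move=> /OA.
  by exists i.
move=> i; rewrite /nowhere_dense -subset0 => f /= /Cn_nbhsP -/(_ cX)[e e0 eA].
(* [n.+1] pays for the passage from the maximum norm to the Euclidean distance, 2 for the strictness
   lost in the supremum. *)
pose e' := e / n.+1%:R / 2.
have e'0 : 0 < e' by rewrite !divr_gt0.
have [g [cg fg [r r0 gO]]] := dO i f e' (@cts_fun _ _ f) e'0.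
have [G GE] : exists G : Cn R X n, forall x, G x = g x.
  by exists (mkcts cg : Cn R X n).
have fG : sup_dist f G < e.
  have [[x0 _]|X0] := pselect ([set: X] !=set0); last first.
    have -> : sup_dist f G = 0 => //.
    rewrite /sup_dist; suff -> : [set: X] = set0 by rewrite image_set0 sup0.
    by apply/seteqP; split => // x _; apply: X0; exists x.
  apply: (@le_lt_trans _ _ (e / 2)); last by rewrite ltr_pdivrMr// ltr_pMr// ltr1n.
  apply: ge_sup; first by exists (Defs.edist (f x0) (G x0)), x0.
  move=> _ [x _ <-]; apply: (le_trans (norm_edist _ _)).
  rewrite GE; apply: (@le_trans _ _ (n.+1%:R * e')).
    by apply: ler_pM => //; [rewrite ler_nat|exact/ltW].
  by rewrite /e' mulrA (mulrC _ (e / _)) divfK.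
have := eA _ fG => /(_ [set h : Cn R X n | O i h]) []; last first.
  by move=> h [[_ nO] Oh].
apply: (unif _ _ _ r0) => h gh; apply: gO; first exact: cts_fun.
by move=> x; rewrite -GE; exact: gh.
Qed.

End dense_interior.

(** * Stable values *)

Section stable_values.
Variables (R : realType) (X : metricType R).
Hypothesis compactX : compact [set: X].

Lemma compact_range_bounded n (f : X -> 'rV[R]_n) : continuous f ->
  exists2 M, 0 < M & forall x, `|f x| <= M.
Proof.
move=> cf; have : compact (range f).
  by apply: continuous_compact => //; exact: continuous_subspaceT.
move=> /compact_bounded[M [_ /(_ (`|M| + 1))]].
have -> : M < `|M| + 1 by rewrite (le_lt_trans (ler_norm M))// ltrDl.
move=> /(_ isT) fM; exists (`|M| + 1); first by rewrite ltr_wpDl.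
by move=> x; apply: fM; exists x.
Qed.

(** The coordinates are the distances to the points of a net whose scale is a third of a Lebesgue
    number: a point nearly as close as [x] to a net point near [x] is close to [x]. *)
Lemma distance_coordinates p (U : 'I_p -> set X) :
  (forall i, open (U i)) -> \bigcup_i U i = setT ->
  exists (N : nat) (F : X -> 'rV[R]_N) (d : R), [/\ 0 < d, continuous F &
    forall x, exists i, forall y,
      (forall l, `|F x ord0 l - F y ord0 l| < d) -> U i y].
Proof.
move=> oU Ucov.
have [d d0 dU] : exists2 d, 0 < d & forall x, exists i, forall y : X,
    mdist x y < d -> U i y.
  apply: lebesgue_number => // [x y z|x r|x].
  - exact: metric_triangle.
  - exact: nbhs_mdist.
  have [i _ Ux] : (\bigcup_i U i) x by rewrite Ucov.
  have /nbhs_ballP[r /= r0 rU] : nbhs x (U i) by exact: open_nbhs_nbhs.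
  by exists i, r => // y xy; apply: rU; rewrite ballEmdist.
have d30 : 0 < d / 3 by rewrite divr_gt0.
have [s sP] := finite_net compactX (fun x => nbhs_mdist x d30).
exists (size s), (fun x => \row_l mdist (tnth (in_tuple s) l) x), (d / 3).
split => // [|x].
  apply: continuous_row => l; under eq_fun do rewrite mxE.
  exact: continuous_mdist.
have [i iU] := dU x; exists i => y xy; apply: iU.
have [q qs /= qx] := sP x; have ls : (index q s < size s)%N by rewrite index_mem.
have := xy (Ordinal ls); rewrite !mxE (tnth_nth q) /= nth_index//.
have := metric_triangle x q y; rewrite (metric_sym x q) ltr_distl.
by move=> h1 /andP[h2 h3]; lra.
Qed.

Lemma avoid_uniform (k : nat) (h : 'I_k -> X -> R) (y : 'I_k -> R) :
  (forall j, continuous (h j)) -> (forall x, exists j, h j x != y j) ->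
  exists2 t, 0 < t & forall x, exists j, t < `|h j x - y j|.
Proof.
move=> ch hy.
have /choice[J JP] : forall x, exists j, h j x != y j by [].
have t0 x : 0 < `|h (J x) x - y (J x)| / 2.
  by rewrite divr_gt0// normr_gt0 subr_eq0 JP.
have nU x : nbhs x [set z | `|h (J x) x - y (J x)| / 2 < `|h (J x) z - y (J x)|].
  have /cvg_ballP/(_ _ (t0 x)) := ch (J x) x.
  apply: filterS => z; rewrite -ball_normE/= => hz.
  have := ler_normD (h (J x) x - h (J x) z) (h (J x) z - y (J x)).
  rewrite subrKA; lra.
have [s sP] := finite_net compactX nU.
exists (\big[Num.min/1]_(p <- s) (`|h (J p) p - y (J p)| / 2)).
  by elim/big_ind : _ => // a b a0 b0; rewrite lt_min a0 b0.
move=> x; have [q qs qx] := sP x; exists (J q); apply: le_lt_trans qx.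
exact: (@ge_bigmin_seq _ _ _ s _ q xpredT _ qs).
Qed.

Section stable_value.
Variables (n k : nat) (kn : (k <= n)%N).

Definition stable_value (f : X -> 'rV[R]_n) :=
  exists (y : 'I_k -> R) (e : R), 0 < e /\
    forall h : 'I_k -> X -> R, (forall i, continuous (h i)) ->
      (forall i x, `|h i x - f x ord0 (widen_ord kn i)| < e) ->
      exists x, forall i, h i x = y i.

(* Where f0 is nearly constant it can be replaced by f0 p plus a small multiple
   of k coordinates of F; as the result has no stable value, these coordinates
   can be made to miss the point c. *)
Lemma unstable_avoid (f0 : X -> 'rV[R]_n) (r : R) : continuous f0 -> 0 < r ->
  (forall g : X -> 'rV[R]_n, continuous g -> (forall x, `|f0 x - g x| < r) ->
    ~ stable_value g) ->
  forall N (s : 'I_k -> 'I_N) (c : 'I_k -> R) (p : X), injective s ->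
  dense_interior [set F : X -> 'rV[R]_N |
    forall x, `|f0 x - f0 p| <= r / 4 -> exists j, F x ord0 (s j) != c j].
Proof.
move=> cf0 r0 unst N s c p injs F e cF e0.
(* The shifted coordinates [s j] of [F] fill the first [k] of [n] coordinates; the others are 0. *)
pose G (m : 'I_n) x := oapp (fun j => F x ord0 (s j) - c j) 0
  (insub (m : nat) : option 'I_k).
have cG m : continuous (G m).
  rewrite /G; case: insub => [j|] /=; last exact: cst_continuous.
  move=> x; apply: cvgB; last exact: cvg_cst.
  exact: continuous_coord.
have [M M0 GM] : exists2 M, 0 < M & forall m x, `|G m x| <= M.
  have cGr : continuous (fun x => \row_m G m x : 'rV[R]_n).
    apply: continuous_row => m; under eq_fun do rewrite mxE.
    exact: cG.
  have [M M0 MP] := compact_range_bounded cGr.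
  exists M => // m x; apply: le_trans (MP x).
  by have := coord_norm_le (\row_m G m x) m; rewrite mxE.
(* Then [c0 * G] is at most [r / 4]; together with the [r / 2] from the cut-off below, [f] stays
   within [r] of [f0]. *)
pose c0 := r / (4 * M).
have c00 : 0 < c0 by rewrite divr_gt0// mulr_gt0.
(* A cut-off, 1 where [f0] is within [r / 4] of [f0 p] and 0 from distance [r / 2] on. Below, [f] is
   [f0 p + c0 * G] on the first region and [f0] on the second. *)
pose chi x := Num.max 0 (1 - Num.max 0 (4 / r * `|f0 x - f0 p| - 1)).
have cchi : continuous chi.
  have c1 : continuous (fun x => 4 / r * `|f0 x - f0 p| - 1).
    move=> x; apply: cvgB; last exact: cvg_cst.
    apply: cvgMr; apply: cvg_norm; apply: cvgB; first exact: cf0.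
    exact: cvg_cst.
  have c2 := continuous_max0 c1.
  apply: (@continuous_max0 _ _ (fun x => 1 - _)) => x.
  by apply: cvgB; [exact: cvg_cst|exact: c2].
have chi1 x : `|f0 x - f0 p| <= r / 4 -> chi x = 1.
  move=> fx; have h : 4 / r * `|f0 x - f0 p| - 1 <= 0.
    by rewrite subr_le0 mulrAC ler_pdivrMr// mul1r; lra.
  by rewrite /chi (max_l h) subr0 max_r.
have chi01 x : 0 <= chi x <= 1.
  rewrite /chi le_max lexx/= ge_max ler01/= gerBl le_max lexx//.
have chi0 x : r / 2 <= `|f0 x - f0 p| -> chi x = 0.
  move=> fx; rewrite /chi max_l// subr_le0 le_max; apply/orP; right.
  by rewrite lerBrDr mulrAC ler_pdivlMr//; lra.
pose f x : 'rV[R]_n := \row_m (f0 x ord0 m +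
  chi x * (f0 p ord0 m - f0 x ord0 m + c0 * G m x)).
have cf : continuous f.
  apply: continuous_row => m; under eq_fun do rewrite mxE.
  move=> x; apply: cvgD; first exact: continuous_coord.
  apply: cvgM; first exact: cchi.
  apply: cvgD; last by apply: cvgMr; exact: cG.
  by apply: cvgB; [exact: cvg_cst|exact: continuous_coord].
have f0f x : `|f0 x - f x| < r.
  apply: row_norm_lt => // m; rewrite !mxE opprD addrA subrr sub0r normrN.
  have [fx|/chi0 ->] := ltP `|f0 x - f0 p| (r / 2); last first.
    by rewrite mul0r normr0.
  have /andP[c0x cx1] := chi01 x; rewrite normrM (ger0_norm c0x).
  have h1 : `|f0 p ord0 m - f0 x ord0 m| < r / 2.
    rewrite distrC; apply: le_lt_trans fx.
    by have := coord_norm_le (f0 x - f0 p) m; rewrite !mxE.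
  have h2 : `|c0 * G m x| <= r / 4.
    rewrite normrM gtr0_norm// (_ : r / 4 = c0 * M).
      by apply: ler_wpM2l => //; exact: ltW.
    by rewrite /c0; field; rewrite gt_eqF.
  apply: (@le_lt_trans _ _ `|f0 p ord0 m - f0 x ord0 m + c0 * G m x|).
    by rewrite ler_piMl.
  by apply: (le_lt_trans (ler_normD _ _)); lra.
have ce0 : 0 < c0 * (e / 2) by apply: mulr_gt0 => //; exact: divr_gt0.
have noval :
    ~ forall h : 'I_k -> X -> R, (forall i, continuous (h i)) ->
      (forall i x, `|h i x - f x ord0 (widen_ord kn i)| < c0 * (e / 2)) ->
      exists x, forall i, h i x = f0 p ord0 (widen_ord kn i).
  move=> H; apply: (unst f cf f0f).
  by exists (fun i => f0 p ord0 (widen_ord kn i)), (c0 * (e / 2)).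
have [h nh] := (existsNP _).2 noval.
have [ch nh'] := (not_implyP _ _).1 nh.
have [hf hy] := (not_implyP _ _).1 nh'.
have hy' x : exists j, h j x != f0 p ord0 (widen_ord kn j).
  apply: contrapT => /forallNP H; apply: hy; exists x => i.
  by have /negP/negPn/eqP := H i.
have [t t0 tP] := avoid_uniform ch hy'.
(* The change from [f] to [h] is moved back to the coordinates [s j]. Where [chi] is 1, coordinate
   [s j] of [F + Dx] differs from [c j] by [(h j - f0 p) / c0], which for some [j] exceeds [t / c0]
   in absolute value. *)
pose D l x := oapp (fun j => (h j x - f x ord0 (widen_ord kn j)) / c0) 0
  [pick j | s j == l].
have cD l : continuous (D l).
  rewrite /D; case: pickP => [j _|_] /=; last exact: cst_continuous.
  move=> x; apply: cvgMl; apply: cvgB; first exact: ch.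
  exact: continuous_coord.
pose Dx x : 'rV[R]_N := \row_l D l x.
exists (fun x => F x + Dx x); split.
- move=> x; apply: cvgD; first exact: cF.
  by apply: continuous_row => l; under eq_fun do rewrite mxE; exact: cD.
- move=> x; rewrite opprD addrA subrr sub0r normrN.
  apply: row_norm_lt => [|l]; [by []|rewrite mxE /D].
  case: pickP => [j _|_] /=; last by rewrite normr0.
  rewrite normrM normfV (gtr0_norm c00) ltr_pdivrMr//.
  by apply: (lt_trans (hf j x)); nra.
exists (t / c0); first exact: divr_gt0.
move=> F' cF' FF' x /chi1 chix.
have [j jP] := tP x; exists j; apply/eqP => F'c.
have := le_lt_trans (coord_norm_le _ (s j)) (FF' x).
rewrite !mxE F'c /D; case: pickP => [j' /eqP/injs ->|/(_ j)]; last by rewrite eqxx.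
have insubw : insub (widen_ord kn j : nat) = Some j :> option 'I_k.
  exact: valK.
rewrite /= mxE chix mul1r /G insubw/=.
rewrite ltr_pdivlMr// -[X in _ * X](gtr0_norm c00) -normrM.
rewrite (_ : _ * c0 = h j x - f0 p ord0 (widen_ord kn j)).
  by move=> /(lt_trans jP); rewrite ltxx.
by field; rewrite gt_eqF.
Qed.

End stable_value.
End stable_values.

Section stable_value_dense.
Variables (R : realType) (X : metricType R).
Hypothesis compactX : compact [set: X].

Lemma dense_interior_stable_value (x0 : X) (n k : nat) (kn : (k.+1 <= n)%N) :
  ~ covering_dim_le X k -> dense_interior (@stable_value R X n k.+1 kn).
Proof.
move=> ndim f0 r cf0 r0.
have [[g [cg f0g [y [e [e0 ge]]]]]|nst] := pselect (exists g : X -> 'rV[R]_n,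
    [/\ continuous g, forall x, `|f0 x - g x| < r & stable_value kn g]).
  exists g; split => //; exists (e / 2); first exact: divr_gt0.
  move=> h ch gh; exists y, (e / 2); split; first exact: divr_gt0.
  move=> h' ch' hh'; apply: ge => // i x.
  rewrite -(subrKA (h x ord0 (widen_ord kn i))) (splitr e).
  apply: (le_lt_trans (ler_normD _ _)); rewrite ltrD//.
  rewrite distrC; apply: le_lt_trans (gh x).
  by have := coord_norm_le (g x - h x) (widen_ord kn i); rewrite !mxE.
exfalso; apply: ndim => p U oU Ucov.
have [N [F0 [d [d0 cF0 F0U]]]] := distance_coordinates compactX oU Ucov.
have [M M0 F0M] := compact_range_bounded compactX cF0.
(* Cells of side [d / 2] leave room for moving both points of a cell by [d / 4]. *)
pose m : R := d / 2; have m0 : 0 < m by rewrite divr_gt0.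
(* The origins differ by fractions of the mesh, so that no number lies on two of the lattices
   [a j + m * z]. *)
pose a (j : 'I_k.+1) : R := - (M + 2 * d) + m * (j%:R / k.+1%:R).
pose B := (Num.trunc ((2 * M + 4 * d) / m)).+1.
have ja (j : 'I_k.+1) : 0 <= (j%:R / k.+1%:R : R) <= 1.
  by rewrite divr_ge0//= ler_pdivrMr// mul1r ler_nat ltnW.
have nU p' : nbhs p' [set x | `|f0 x - f0 p'| <= r / 4].
  have r40 : 0 < r / 4 by rewrite divr_gt0.
  have /cvg_ballP/(_ _ r40) := cf0 p'; apply: filterS => x.
  by rewrite -ball_normE/= distrC => /ltW.
have [s sP] := finite_net compactX nU.
pose I := ({ffun 'I_k.+1 -> 'I_N} * {ffun 'I_k.+1 -> 'I_B})%type.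
(* An index chooses one coordinate and one lattice point for each grid, and a region where [f0] is
   nearly constant. There are finitely many once the regions come from a net. *)
pose O (t : (I * X)%type) := [set F : X -> 'rV[R]_N | injective t.1.1 ->
  forall x, `|f0 x - f0 t.2| <= r / 4 ->
  exists j, F x ord0 (t.1.1 j) != a j + m * (t.1.2 j)%:R].
have dO t : dense_interior (O t).
  have [injt|ninj] := pselect (injective t.1.1).
    apply: dense_interiorS (unstable_avoid compactX cf0 r0 _
      (fun j => a j + m * (t.1.2 j)%:R) t.2 injt) => [F FO _ //|].
    by move=> g cg f0g sg; apply: nst; exists g.
  by apply: dense_interiorS (@dense_interior_setT _ _ _) => F _ /ninj.
have d40 : 0 < d / 4 by rewrite divr_gt0.
have [F [cF F0F [e e0 FO]]] := dense_interior_seq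
  [seq (t, q) | t <- enum {: I}, q <- s] dO cF0 d40.
have {FO} FO t q : q \in s -> O (t, q) F.
  move=> qs; apply: (FO F cF) => [x|]; first by rewrite subrr normr0.
  by apply: allpairs_f => //; rewrite mem_enum.
have FF0 x i : `|F0 x ord0 i - F x ord0 i| < d / 4.
  apply: le_lt_trans (F0F x).
  by have := coord_norm_le (F0 x - F x) i; rewrite !mxE.
have FM x i : - (M + d) <= F x ord0 i <= M + d.
  have := le_trans (coord_norm_le (F0 x) i) (F0M x); have := FF0 x i.
  by rewrite ltr_distl ler_norml => /andP[h1 h2] /andP[h3 h4]; lra.
apply: (@grid_cover _ _ N k.+1 B p (fun i x => F x ord0 i) a m U x0) => //.
- by move=> i; exact: continuous_coord.
- move=> j i x; have := FM x i; have := ja j.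
  have hB : 2 * M + 4 * d < m * B%:R.
    rewrite -ltr_pdivrMl// mulrC.
    have /truncn_itv/andP[] // : 0 <= (2 * M + 4 * d) / m.
    by apply: divr_ge0; [lra|exact: ltW].
  move=> /andP[j0 j1] /andP[F1 F2].
  have mj1 : m * (j%:R / k.+1%:R) <= m by rewrite ler_piMr// ltW.
  have mj0 : 0 <= m * (j%:R / k.+1%:R) by rewrite mulr_ge0// ltW.
  have md : m = d / 2 by [].
  rewrite /a; move: hB mj1 mj0 F1 F2 md.
  move: (m * B%:R) (m * (_ / _)) (F x ord0 i) => mB mq Fx *.
  by apply/andP; split; lra.
- move=> x; apply: contrapT => /forallNP nx.
  have /choice[iz izP] : forall j : 'I_k.+1, exists iz : 'I_N * 'I_B,
      F x ord0 iz.1 = a j + m * iz.2%:R.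
    move=> j; have /existsNP[i /existsNP[z /negP/negPn/eqP]] := nx j.
    by exists (i, z).
  have [q qs fxq] := sP x.
  pose t : I := ([ffun j => (iz j).1], [ffun j => (iz j).2]).
  have [j] : exists j, F x ord0 (t.1 j) != a j + m * (t.2 j)%:R.
    (* The chosen coordinates are distinct: one coordinate used by two grids would lie on both
       lattices, and comparison modulo [k.+1] gives [j = j']. *)
    apply: (FO t q qs) => // j j'; rewrite /= !ffunE => ijj'; have := izP j; rewrite ijj' (izP j') => /eqP.
    rewrite /a -!addrA => /eqP/addrI; rewrite -!mulrDr => /mulfI.
    rewrite gt_eqF// => /(_ isT)/(congr1 ( *%R^~ k.+1%:R))/eqP.
    rewrite !mulrDl !divfK ?pnatr_eq0// -!natrM -!natrD eqr_nat => /eqP jj.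
    apply/val_inj; rewrite /= -(modn_small (ltn_ord j)) -(modn_small (ltn_ord j')).
    by rewrite -(modnMDl (iz j).2) addnC -jj addnC modnMDl.
  by rewrite /= !ffunE izP eqxx.
- move=> x; have [i iU] := F0U x; exists i => y Fxy; apply: iU => l.
  have := Fxy l; have := FF0 x l; have := FF0 y l; rewrite /m !ltr_distl.
  by move=> /andP[? ?] /andP[? ?] /andP[? ?]; apply/andP; split; lra.
Qed.

End stable_value_dense.

(** * Box counting *)

Section grid_covered.
Variables (R : realType) (n : nat).
Implicit Types (A : set 'rV[R]_n) (s : seq 'rV[R]_n).

Definition ball_cover s (r : R) A :=
  forall x, A x -> exists2 c, c \in s & `|x - c| <= r.

(* A has at most the box-counting size of a d-dimensional cube. *)
Definition grid_covered (d : nat) A := exists C : nat, forall M : nat,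
  (0 < M)%N -> exists s, (size s <= C * M ^ d)%N /\
    ball_cover s (C%:R / M%:R) A.

Lemma grid_coveredS d A A' : A `<=` A' -> grid_covered d A' -> grid_covered d A.
Proof.
move=> AA' [C CP]; exists C => M /CP[s [sC sA']]; exists s; split => // x Ax.
by apply: sA'; exact: AA'.
Qed.

Lemma grid_covered_bigcup (I : finType) d (A : I -> set 'rV[R]_n) :
  (forall i, grid_covered d (A i)) -> grid_covered d (\bigcup_i A i).
Proof.
move=> /choice[C CP]; exists (\sum_i C i)%N => M M0.
have /choice[s sP] : forall i, exists s, (size s <= C i * M ^ d)%N /\
    ball_cover s ((C i)%:R / M%:R) (A i) by move=> i; exact: CP.
exists (flatten [seq s i | i <- enum I]); split.
  rewrite size_flatten /shape -map_comp sumnE big_map big_enum/= big_distrl/=.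
  by apply: leq_sum => i _; exact: (sP i).1.
move=> x [i _ Aix]; have [c cs xc] := (sP i).2 x Aix; exists c.
  by apply/flatten_mapP; exists i => //; rewrite mem_enum.
apply: (le_trans xc); rewrite ler_pM2r ?invr_gt0 ?ltr0n// ler_nat.
by rewrite (bigD1 i)//= leq_addr.
Qed.

Lemma grid_covered_parallelepiped d (v : 'rV[R]_n) (w : 'I_d -> 'rV[R]_n) :
  grid_covered d [set x | exists t : 'I_d -> R,
    (forall l, 0 <= t l <= 1) /\ x = v + \sum_l t l *: w l].
Proof.
(* [2 ^ d] absorbs the [(M + 1) ^ d] lattice points, the other summand bounds the radius. *)
set S := \sum_l `|w l|; exists (2 ^ d + (Num.trunc S).+1)%N => M M0.
exists [seq v + \sum_l ((m l : nat)%:R / M%:R) *: w l |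
  m : {ffun 'I_d -> 'I_M.+1} <- enum {: {ffun 'I_d -> 'I_M.+1}}]; split.
  rewrite size_map -cardE card_ffun !card_ord mulnDl.
  apply: leq_trans (leq_addr _ _); rewrite -expnMn.
  by have [->|d0] := posnP d; rewrite ?expn0// leq_exp2r//; lia.
move=> _ [t [t01 ->]].
have tM0 l : 0 <= t l * M%:R by have /andP[? _] := t01 l; rewrite mulr_ge0.
have tM l : (Num.trunc (t l * M%:R) < M.+1)%N.
  rewrite ltnS -(ler_nat R); have /andP[h _] := truncn_itv (tM0 l).
  by apply: (le_trans h); have /andP[_ ?] := t01 l; rewrite ler_piMl.
pose m := [ffun l => Ordinal (tM l)].
exists (v + \sum_l ((m l : nat)%:R / M%:R) *: w l).
  by apply/mapP; exists m => //; rewrite mem_enum.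
have Mgt0 : 0 < M%:R :> R by rewrite ltr0n.
rewrite opprD addrACA subrr add0r -sumrB; apply: (le_trans (ler_norm_sum _ _ _)).
apply: (@le_trans _ _ (S / M%:R)).
  rewrite /S mulr_suml; apply: ler_sum => l _.
  rewrite -scalerBl normrZ mulrC; apply: ler_wpM2l => //.
  rewrite ffunE /= -(ler_pM2r Mgt0) mulVf ?gt_eqF// -[X in _ * X](gtr0_norm Mgt0).
  rewrite -normrM mulrBl divfK ?gt_eqF//.
  have /andP[h1 h2] := truncn_itv (tM0 l); rewrite ger0_norm ?subr_ge0//.
  by rewrite lerBlDl natr1 ltW.
rewrite ler_pM2r ?invr_gt0// natrD; apply: ler_wpDl => //.
have /truncn_itv/andP[_ /ltW//] : 0 <= S by exact: sumr_ge0.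
Qed.

Lemma grid_covered_bounded A B : (forall x, A x -> `|x| <= B) ->
  grid_covered n A.
Proof.
move=> AB; have [->|/set0P[x0 Ax0]] := eqVneq A set0.
  by exists 0%N => M M0; exists [::]; split => // x [].
have [B0|Bn0] := eqVneq B 0.
  exists 1%N => M M0; exists [:: 0]; rewrite /= mul1n expn_gt0 M0; split => // x.
  move=> /AB; rewrite B0 => x0'; exists 0; rewrite ?inE// subr0.
  by apply: (le_trans x0'); rewrite divr_ge0.
have Bgt0 : 0 < B by rewrite lt_def Bn0 (le_trans _ (AB _ Ax0)).
apply: grid_coveredS (grid_covered_parallelepiped (const_mx (- B))
  (fun l : 'I_n => (2 * B) *: delta_mx ord0 l)).
move=> x /AB xB; exists (fun l => (x ord0 l + B) / (2 * B)); split.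
  move=> l; have := le_trans (coord_norm_le x l) xB; rewrite ler_norml => /andP[? ?].
  have B2 : 0 < 2 * B by rewrite mulr_gt0.
  by rewrite divr_ge0 ?(ltW B2) /= ?ler_pdivrMr//; lra.
apply/rowP => j; rewrite !mxE summxE (bigD1 j)//= !mxE !eqxx mulr1.
rewrite big1 => [|i ij]; first by rewrite addr0; field; rewrite gt_eqF.
by rewrite !mxE eqxx (eq_sym j) (negbTE ij) !mulr0.
Qed.

(* A convex combination of at most d + 1 points among the v_j is the sum of one
   of them and a combination of d edge vectors with coefficients in [0, 1]. *)
Lemma grid_covered_nerve (T : Type) d q (lam : 'I_q -> T -> R)
    (v : 'I_q -> 'rV[R]_n) :
  (forall j x, 0 <= lam j x) -> (forall x, \sum_j lam j x = 1) ->
  (forall x, (#|[pred j | (lam j x != 0)%R]| <= d.+1)%N) ->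
  grid_covered d (range (fun x => \sum_j lam j x *: v j)).
Proof.
move=> lam0 lam1 lamd.
pose I := ('I_q * {ffun 'I_d -> 'I_q})%type.
apply: (@grid_coveredS _ _ (\bigcup_(i : I) [set x | exists t : 'I_d -> R,
    (forall l, 0 <= t l <= 1) /\
    x = v i.1 + \sum_l t l *: (v (i.2 l) - v i.1)])); last first.
  by apply: grid_covered_bigcup => i; exact: grid_covered_parallelepiped.
move=> _ [x _ <-].
have [j0 lj0] : exists j, lam j x != 0.
  apply: contrapT => /forallNP l0; have := lam1 x; rewrite big1 => [/eqP|j _].
    by rewrite eq_sym oner_eq0.
  by have /negP/negPn/eqP := l0 j.
pose s := [seq j <- enum 'I_q | (lam j x != 0) && (j != j0)].
have sd : (size s <= d)%N.
  rewrite -ltnS; apply: leq_trans (lamd x).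
  rewrite (cardD1 j0) inE lj0 add1n ltnS cardE /enum_mem -enumT/=.
  rewrite size_filter /s size_filter.
  by apply/eq_leq/eq_count => j; rewrite !inE andbC.
(* Past the end of [s] the default [j0] gives edge vectors equal to 0. *)
exists (j0, [ffun l : 'I_d => nth j0 s l]) => //=.
exists (fun l => lam (nth j0 s l) x); split => [l|].
  by rewrite lam0 -(lam1 x) (bigD1 (nth j0 s l))//= lerDl sumr_ge0.
transitivity (v j0 + \sum_j lam j x *: (v j - v j0)).
  under [in RHS]eq_bigr do rewrite scalerBr.
  by rewrite sumrB -scaler_suml lam1 scale1r addrC subrK.
congr (_ + _); transitivity (\sum_(j <- s) lam j x *: (v j - v j0)).
  rewrite /s big_filter big_enum_cond/= (bigID (fun j => (lam j x != 0) && (j != j0)))/=.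
  rewrite [X in _ + X]big1 ?addr0// => j; rewrite negb_and !negbK.
  by case/orP => /eqP ->; rewrite ?scale0r// subrr scaler0.
under [RHS]eq_bigr do rewrite ffunE.
pose G l := lam (nth j0 s l) x *: (v (nth j0 s l) - v j0).
rewrite (big_nth j0) -/(G _) -(big_mkord xpredT G) [RHS](big_cat_nat (n := size s))//=.
rewrite [X in _ + X]big_nat_cond [X in _ + X]big1 ?addr0// => l.
by move=> /andP[/andP[sl _] _]; rewrite /G nth_default// subrr scaler0.
Qed.

Lemma separated_card A s r (I : finType) (u : I -> 'rV[R]_n) :
  ball_cover s r A -> (forall i, A (u i)) ->
  (forall i j, i != j -> 2 * r < `|u i - u j|) -> (#|I| <= size s)%N.
Proof.
move=> sA Au usep.
have /choice[c cP] : forall i, exists c, c \in s /\ `|u i - c| <= r.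
  by move=> i; have [c cs uc] := sA _ (Au i); exists c.
have injc : injective c.
  move=> i j cij; apply/eqP; apply: contrapT => /negP /usep; apply/negP.
  rewrite -leNgt -(subrKA (c i)); apply: (le_trans (ler_normD _ _)).
  rewrite mulrDl mul1r; apply: lerD; first exact: (cP i).2.
  by rewrite distrC cij; exact: (cP j).2.
rewrite cardE -(size_map c); apply: uniq_leq_size.
  by rewrite map_inj_uniq// enum_uniq.
by move=> _ /mapP[i _ ->]; exact: (cP i).1.
Qed.

(* A cube contains a grid of L ^ n points at mutual distance of order 1 / L,
   too many to lie in A when d < n. *)
Lemma grid_covered_miss d A (y : 'rV[R]_n) (e : R) : (d < n)%N ->
  grid_covered d A -> 0 < e -> exists2 z, `|z - y| < e & ~ A z.
Proof.
move=> dn [C CP] e0; apply: contrapT => nz.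
have yA z : `|z - y| < e -> A z.
  by move=> zy; apply: contrapT => Az; apply: nz; exists z.
(* [K > 4 * C / e] makes twice the covering radius [C / (L * K)] smaller than the spacing
   [e / (2 * L)]; [L > C * K ^ d] makes the [L ^ n] grid points outnumber the [C * (L * K) ^ d]
   balls. *)
pose K := (Num.trunc (4 * C%:R / e)).+1.
pose L := (C * K ^ d).+1.
have LK0 : (0 < L * K)%N by [].
have [s [sC sA]] := CP _ LK0.
pose u (m : {ffun 'I_n -> 'I_L}) : 'rV[R]_n :=
  y + \row_i (e / (2 * L%:R) * (m i)%:R).
have Lgt0 : 0 < L%:R :> R by rewrite ltr0n.
have eL0 : 0 < e / (2 * L%:R) by rewrite divr_gt0// mulr_gt0.
have : (#|{: {ffun 'I_n -> 'I_L}}| <= size s)%N.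
  apply: (separated_card sA (u := u)) => [m|m m' mm'].
    apply: yA; rewrite /u addrC addKr; apply: row_norm_lt => // i.
    rewrite mxE ger0_norm ?mulr_ge0// ?ltW//.
    apply: (@le_lt_trans _ _ (e / (2 * L%:R) * L%:R)).
      by apply: ler_wpM2l; [exact: ltW|rewrite ler_nat ltnW].
    rewrite (_ : _ * L%:R = e / 2); first by rewrite ltr_pdivrMr// ltr_pMr// ltr1n.
    by field; rewrite gt_eqF.
  have [i mi] : exists i, m i != m' i.
    apply: contrapT => /forallNP eqm; move/eqP : mm'; apply; apply/ffunP => i.
    by have /negP/negPn/eqP := eqm i.
  apply: lt_le_trans (coord_norm_le _ i).
  rewrite !mxE opprD addrACA subrr add0r -mulrBr normrM (gtr0_norm eL0).
  apply: (@lt_le_trans _ _ (e / (2 * L%:R))); last first.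
    rewrite ler_pMr// ler_normr; move: mi; rewrite -(inj_eq val_inj)/= neq_ltn.
    by case/orP; rewrite -(ler_nat R) -natr1 => ?; apply/orP; [right|left]; lra.
  have : 4 * C%:R / e < K%:R.
    have /truncn_itv/andP[] // : 0 <= 4 * C%:R / e.
    by rewrite divr_ge0 ?mulr_ge0// ltW.
  rewrite ltr_pdivrMr// natrM => CK.
  have Kgt0 : 0 < K%:R :> R by rewrite ltr0n.
  rewrite ltr_pdivlMr ?mulr_gt0// (_ : _ * _ * _ = 4 * C%:R / K%:R).
    by rewrite ltr_pdivrMr// (mulrC e).
  by field; rewrite !gt_eqF.
rewrite card_ffun !card_ord => Ls; have := leq_trans Ls sC.
have h : (L ^ d.+1 <= L ^ n)%N by rewrite leq_pexp2l.
move=> /(leq_trans h); rewrite expnMn mulnCA expnS mulnC leq_pmul2l ?expn_gt0//.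
by rewrite ltnn.
Qed.

End grid_covered.

(** * Partitions of unity and maps through nerves *)

Section nerve.
Variables (R : realType) (X : metricType R).
Hypothesis compactX : compact [set: X].

(** Each net point carries a hat function supported in one chosen [W j]; the hats are grouped by [j]
    and divided by their total. *)
Lemma partition_of_unity q (W : 'I_q -> set X) :
  (forall j, open (W j)) -> \bigcup_j W j = setT ->
  exists lam : 'I_q -> X -> R, [/\ forall j, continuous (lam j),
    forall j x, 0 <= lam j x, forall x, \sum_j lam j x = 1 &
    forall j x, lam j x != 0 -> W j x].
Proof.
move=> oW Wcov.
have /choice[J JP] : forall x : X, exists jr : 'I_q * R, 0 < jr.2 /\
    forall y, mdist x y < jr.2 -> W jr.1 y.
  move=> x; have [j _ Wx] : (\bigcup_j W j) x by rewrite Wcov.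
  have /nbhs_ballP[r /= r0 rW] : nbhs x (W j) by exact: open_nbhs_nbhs.
  by exists (j, r); split => // y xy; apply: rW; rewrite ballEmdist.
have [s sP] := finite_net compactX (fun x => nbhs_mdist x (JP x).1).
pose hat p y : R := Num.max 0 ((J p).2 - mdist p y).
have hat0 p y : 0 <= hat p y by rewrite /hat le_max lexx.
have chat p : continuous (hat p).
  apply: (@continuous_max0 _ _ (fun y => (J p).2 - mdist p y)) => y.
  by apply: cvgB; [exact: cvg_cst|exact: continuous_mdist].
pose g j y := \sum_(p <- s | (J p).1 == j) hat p y.
have cg j : continuous (g j).
  rewrite /g; under eq_fun do rewrite -big_filter.
  exact: continuous_sum.
have g0 j y : 0 <= g j y by exact: sumr_ge0.
pose G y := \sum_j g j y.
have cG : continuous G by exact: continuous_sum.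
have G0 y : 0 < G y.
  have [p ps /= py] := sP y; have hp : 0 < hat p y by rewrite lt_max subr_gt0 py orbT.
  apply: (lt_le_trans hp); rewrite /G (bigD1 (J p).1)//=.
  rewrite ler_wpDr ?sumr_ge0// /g (big_rem p)//= eqxx lerDl.
  exact: sumr_ge0.
exists (fun j y => g j y / G y); split => [j y|j y|y|j y].
- by apply: cvgM; [exact: cg|apply: cvgV; [rewrite gt_eqF|exact: cG]].
- by rewrite divr_ge0// ltW.
- by rewrite -mulr_suml -/(G y) divff// gt_eqF.
rewrite mulf_eq0 negb_or => /andP[gy _].
have [p _ /andP[/eqP <- hp]] : exists2 p, p \in s & ((J p).1 == j) && (0 < hat p y).
  apply: contrapT => np; move/negP: gy; apply; rewrite /g big_seq_cond big1//.
  move=> p /andP[ps pj]; apply/eqP; rewrite eq_le hat0 andbT leNgt.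
  by apply/negP => hp; apply: np; exists p => //; rewrite pj.
by apply: (JP p).2; move: hp; rewrite lt_max ltxx subr_gt0.
Qed.

(** The values of [f] at sample points are averaged with a partition of unity. Only members
    containing [x] contribute, which bounds both the error and the number of vertices involved. *)
Lemma nerve_approximation (x0 : X) n d q (W : 'I_q -> set X)
    (f : X -> 'rV[R]_n) (e : R) :
  (forall j, open (W j)) -> \bigcup_j W j = setT ->
  (forall x, (#|[pred j | x \in W j]| <= d.+1)%N) ->
  (forall j x y, W j x -> W j y -> `|f x - f y| <= e) ->
  exists h : X -> 'rV[R]_n, [/\ continuous h,
    forall x, `|f x - h x| <= e & grid_covered d (range h)].
Proof.
move=> oW Wcov Wd fW.
have [lam [clam lam0 lam1 lamW]] := partition_of_unity oW Wcov.
(* For an empty member [x0] stands in for the sample point. *)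
have /choice[c cP] : forall j, exists c, forall x, W j x -> W j c.
  move=> j; have [[c Wc]|nW] := pselect (exists c, W j c); first by exists c.
  by exists x0 => x Wx; exfalso; apply: nW; exists x.
exists (fun x => \sum_j lam j x *: f (c j)); split.
- apply: continuous_row => i; under eq_fun do rewrite summxE.
  apply: continuous_sum => j; under eq_fun do rewrite mxE.
  by move=> x; apply: cvgMl; exact: clam.
- move=> x; rewrite -[X in X - _]scale1r -(lam1 x) scaler_suml -sumrB.
  apply: (le_trans (ler_norm_sum _ _ _)).
  apply: (@le_trans _ _ (\sum_j lam j x * e)); last by rewrite -mulr_suml lam1 mul1r.
  apply: ler_sum => j _; rewrite -scalerBr normrZ ger0_norm//.
  have [->|/lamW Wx] := eqVneq (lam j x) 0; first by rewrite !mul0r.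
  by apply: ler_wpM2l => //; apply: (fW j) => //; exact: (cP j x).
- apply: grid_covered_nerve => // x; apply: leq_trans (Wd x).
  by apply/subset_leq_card/fintype.subsetP => j jx; apply/mem_set/lamW; exact: jx.
Qed.

(** A fine cover of the image of order [k.+1], pulled back to [X], approximates the first [k.+1]
    coordinates by a map with [k]-dimensional image, which misses a point [z] close to [y]. *)
Lemma stable_value_range_dim (x0 : X) n k (kn : (k.+1 <= n)%N)
    (f : X -> 'rV[R]_n) :
  continuous f -> stable_value kn f -> ~ covering_dim_le (range f) k.
Proof.
move=> cf [y [e [e0 stab]]] dimf.
have e80 : 0 < e / 8 by rewrite divr_gt0.
have [s sP] := finite_net compactX (fun p => continuous_nbhs p cf e80).
pose U (i : 'I_(size s)) : set (range f) :=
  [set z | `|f (tnth (in_tuple s) i) - set_val z| < e / 8].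
have oU i : open (U i).
  apply: (@open_comp _ _ (set_val : range f -> 'rV[R]_n)
    [set z | `|f (tnth (in_tuple s) i) - z| < e / 8]).
    by move=> z _; exact: initial_continuous.
  rewrite (_ : [set _ | _] = ball (f (tnth (in_tuple s) i)) (e / 8)).
    exact: ball_open.
  by rewrite -ball_normE.
have Ucov : \bigcup_i U i = setT.
  apply/seteqP; split => // z _; have /set_mem[x _ xz] := valP z.
  have [p ps px] := sP x; have ls : (index p s < size s)%N by rewrite index_mem.
  by exists (Ordinal ls) => //; rewrite /U/= (tnth_nth p)/= nth_index// set_valE -xz.
have [q [V [oV Vcov VU Vk]]] := dimf _ U oU Ucov.
have fin x : f x \in range f by apply/mem_set; exists x.
pose F x : range f := exist _ (f x) (fin x).
pose g x : 'rV[R]_k.+1 := \row_i f x ord0 (widen_ord kn i).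
have oW j : open (F @^-1` V j).
  have [Q oQ <-] := oV j.
  have -> : F @^-1` (set_val @^-1` Q) = f @^-1` Q by [].
  by apply: open_comp => // x _; exact: cf.
have Wcov : \bigcup_j F @^-1` V j = setT.
  apply/seteqP; split => // x _; have : (\bigcup_j V j) (F x) by rewrite Vcov.
  by case=> j _ Vx; exists j.
have Wk x : (#|[pred j | x \in F @^-1` V j]| <= k.+1)%N.
  exact: Vk (F x).
have gW j x x' : (F @^-1` V j) x -> (F @^-1` V j) x' -> `|g x - g x'| <= e / 4.
  move=> Vx Vx'; have [i VUi] := VU j.
  have h1 : `|f (tnth (in_tuple s) i) - f x| < e / 8 := VUi _ Vx.
  have h2 : `|f (tnth (in_tuple s) i) - f x'| < e / 8 := VUi _ Vx'.
  apply: row_norm_le => [|l]; first by rewrite divr_ge0// ltW.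
  rewrite !mxE; have := coord_norm_le (f x - f x') (widen_ord kn l).
  rewrite !mxE => h3; apply: (le_trans h3).
  rewrite -(subrKA (f (tnth (in_tuple s) i))); apply: (le_trans (ler_normD _ _)).
  by rewrite distrC in h1; lra.
have [h [ch gh hk]] := nerve_approximation x0 oW Wcov Wk gW.
have e40 : 0 < e / 4 by rewrite divr_gt0.
have [z zy nz] := grid_covered_miss (\row_i y i) (ltnSn k) hk e40.
(* After translation by [y - z], hitting [y] would mean that [h] hits [z]. *)
have [i x|i x|x xP] := stab (fun i x => h x ord0 i + (y i - z ord0 i)).
- by apply: cvgD; [exact: continuous_coord|exact: cvg_cst].
- have h1 := le_trans (coord_norm_le _ i) (gh x).
  have h2 := le_lt_trans (coord_norm_le _ i) zy.
  move: h1 h2; rewrite !mxE ler_norml !ltr_norml => /andP[? ?] /andP[? ?].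
  by apply/andP; split; lra.
apply: nz; exists x => //; apply/rowP => i.
by have := xP i; lra.
Qed.

End nerve.

(** * Efficient covers at a single scale *)

Section small_cover.
Variable R : realType.

(** At scale [K ^ - (m + 1)] the box-counting quotient is at most [k + 1 / (m + 1)]. The factor
    [4 * n] allows for doubling the balls and for Euclidean diameters. *)
Definition small_cover n (k m : nat) (A : set 'rV[R]_n) := exists K s,
  [/\ (2 <= K)%N, (size s <= K ^ (k * m.+1 + 1))%N &
      ball_cover s (4 * n%:R * K%:R ^+ m.+1)^-1 A].

(** [K] is chosen large enough to absorb all constants into one extra power. The 8 instead of 4
    keeps half of the radius for perturbations. *)
Lemma grid_covered_small_cover n k m (A : set 'rV[R]_n) : (0 < n)%N ->
  grid_covered k A -> exists K s,
  [/\ (2 <= K)%N, (size s <= K ^ (k * m.+1 + 1))%N &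
      ball_cover s (8 * n%:R * K%:R ^+ m.+1)^-1 A].
Proof.
move=> n0 [C CP]; pose D := (8 * n * C.+1)%N; pose K := (C * D ^ k + 2)%N.
have D0 : (0 < D)%N by rewrite !muln_gt0 n0.
have K0 : (0 < K)%N by rewrite /K addn2.
have DK0 : (0 < D * K ^ m.+1)%N by rewrite muln_gt0 D0 expn_gt0 K0.
have [s [sC sA]] := CP _ DK0; exists K, s; split; first by rewrite leq_addl.
  apply: (leq_trans sC); rewrite expnMn mulnA -expnM addn1 expnS mulnC.
  by rewrite (mulnC k) mulnC leq_mul2r leq_addr orbT.
move=> x /sA[c cs xc]; exists c => //; apply: (le_trans xc).
rewrite ler_pdivrMr ?ltr0n// ler_pdivlMl; last first.
  by rewrite !mulr_gt0 ?exprn_gt0 ?ltr0n.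
rewrite -natrX -!natrM ler_nat mulnAC leq_mul2r /D.
by apply/orP; right; nia.
Qed.

Lemma ball_cover_near (X : Type) n (g h : X -> 'rV[R]_n) s r e :
  ball_cover s r (range g) -> (forall x, `|g x - h x| <= e) ->
  ball_cover s (r + e) (range h).
Proof.
move=> gs gh _ [x _ <-]; have [|c cs gc] := gs (g x); first by exists x.
exists c => //; rewrite -(subrKA (g x)) addrC.
by apply: (le_trans (ler_normD _ _)); rewrite lerD// distrC.
Qed.

Lemma dense_interior_small_cover (X : metricType R) n k m :
  compact [set: X] -> [set: X] !=set0 -> (0 < n)%N ->
  k = n \/ covering_dim_le X k ->
  dense_interior [set f : X -> 'rV[R]_n | small_cover k m (range f)].
Proof.
move=> compactX [x0 _] n0 kdim f e cf e0.
have [g [cg fg gk]] : exists g : X -> 'rV[R]_n, [/\ continuous g,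
    forall x, `|f x - g x| < e & grid_covered k (range g)].
  case: kdim => [->|dimX].
    have [M _ fM] := compact_range_bounded compactX cf.
    exists f; split => // [x|]; first by rewrite subrr normr0.
    by apply: (@grid_covered_bounded _ _ _ M) => _ [x _ <-].
  have e40 : 0 < e / 4 by rewrite divr_gt0.
  have [s sP] := finite_net compactX (fun p => continuous_nbhs p cf e40).
  pose U (i : 'I_(size s)) := [set x | `|f (tnth (in_tuple s) i) - f x| < e / 4].
  have oU i : open (U i).
    rewrite (_ : U i = f @^-1` ball (f (tnth (in_tuple s) i)) (e / 4)).
      by apply: open_comp => [x _|]; [exact: cf|exact: ball_open].
    by rewrite -ball_normE.
  have Ucov : \bigcup_i U i = setT.
    apply/seteqP; split => // x _; have [p ps px] := sP x.
    have ls : (index p s < size s)%N by rewrite index_mem.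
    by exists (Ordinal ls) => //; rewrite /U/= (tnth_nth p)/= nth_index.
  have [q [V [oV Vcov VU Vk]]] := dimX _ U oU Ucov.
  have fV j x x' : V j x -> V j x' -> `|f x - f x'| <= e / 2.
    move=> Vx Vx'; have [i VUi] := VU j; have h1 := VUi _ Vx; have h2 := VUi _ Vx'.
    rewrite -(subrKA (f (tnth (in_tuple s) i))); apply: (le_trans (ler_normD _ _)).
    by move: h1 h2; rewrite /U/= distrC; lra.
  have [h [ch fh hk]] := nerve_approximation compactX x0 oV Vcov Vk fV.
  exists h; split => // x; apply: (le_lt_trans (fh x)).
  by rewrite ltr_pdivrMr// ltr_pMr// ltr1n.
exists g; split => //; have [K [s [K2 sK sg]]] := grid_covered_small_cover m n0 gk.
have r0 : 0 < (8 * n%:R * K%:R ^+ m.+1)^-1 :> R.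
  by rewrite invr_gt0 !mulr_gt0 ?exprn_gt0 ?ltr0n// (ltn_trans _ K2).
exists (8 * n%:R * K%:R ^+ m.+1)^-1 => // h ch gh; exists K, s; split => //.
rewrite (_ : _^-1 = (8 * n%:R * K%:R ^+ m.+1)^-1 + (8 * n%:R * K%:R ^+ m.+1)^-1).
  by apply: ball_cover_near sg _ => x; exact: ltW.
by field; rewrite pnatr_eq0 -lt0n n0 expf_neq0// pnatr_eq0 -lt0n (ltn_trans _ K2).
Qed.

Lemma diam_ball_le n (c : 'rV[R]_n) r d : 0 <= r -> n%:R * (2 * r) <= d ->
  (diam (ball c r) <= d%:E)%E.
Proof.
move=> r0 rd; apply: ge_ereal_sup => _ [->|[x [y [cx cy ->]]]].
  by rewrite lee_fin (le_trans _ rd)// !mulr_ge0.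
rewrite lee_fin (le_trans (norm_edist _ _))// (le_trans _ rd)//.
apply: ler_wpM2l => //; rewrite -(subrKA c); apply: (le_trans (ler_normD _ _)).
move: cx cy; rewrite -ball_normE/= => cx cy; rewrite (distrC x); lra.
Qed.

(** The closed balls are enlarged to open ones of radius [2 * r]; [n] compares the Euclidean
    distance with the maximum norm. *)
Lemma cover_number_le n (A : set 'rV[R]_n) s (r d : R) : 0 < r ->
  n%:R * (4 * r) <= d -> ball_cover s r A ->
  (cover_number d A <= (size s)%:R%:E)%E.
Proof.
move=> r0 rd sA; apply: ereal_inf_lbound; exists (size s) => //=.
exists (fun i => ball (tnth (in_tuple s) i) (2 * r)); split => [i|i|x /sA[c cs xc]].
- exact: ball_open.
- by apply: diam_ball_le; [rewrite mulr_ge0// ltW|lra].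
have ls : (index c s < size s)%N by rewrite index_mem.
exists (Ordinal ls) => //; rewrite (tnth_nth c)/= nth_index// -ball_normE/=.
by rewrite distrC (le_lt_trans xc)// ltr_pMl// ltr1n.
Qed.

(** A set of diameter at most [d] contains at most one of the points. *)
Lemma cover_number_ge n (A : set 'rV[R]_n) (I : finType) (u : I -> 'rV[R]_n) d :
  (forall i, A (u i)) -> (forall i j, i != j -> d < `|u i - u j|) ->
  (#|I|%:R%:E <= cover_number d A)%E.
Proof.
move=> Au usep; apply: le_ereal_inf_tmp => _ [m [U [oU Ud AU]] <-].
rewrite lee_fin ler_nat.
have /choice[t tP] : forall i, exists t, U t (u i).
  by move=> i; have [t _ ut] := AU _ (Au i); exists t.
rewrite -[m]card_ord; apply: (@leq_card _ _ t) => i j tij.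
apply/eqP; apply: contrapT => /negP /usep; apply/negP; rewrite -leNgt.
rewrite -lee_fin; apply: le_trans (Ud (t i)).
apply: (@le_trans _ _ (Defs.edist (u i) (u j))%:E).
  by rewrite lee_fin edist_norm.
apply: ereal_sup_ubound; right; exists (u i), (u j); split => //.
by rewrite tij.
Qed.

End small_cover.

(** * Box dimensions *)

Section dimension_estimates.
Variable R : realType.
Local Open Scope ereal_scope.

Lemma lne_div_le (x : \bar R) (M c t : R) : (0 < c)%R -> (0 < M)%R ->
  x <= M%:E -> (ln M <= t * c)%R -> lne x / c%:E <= t%:E.
Proof.
move=> c0 M0 xM Mt; rewrite inver gt_eqF//.
have ci0 : 0 < (c^-1)%:E by rewrite lte_fin invr_gt0.
case: x xM => [x|//|_] /=; last by rewrite gt0_mulNye// leNye.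
rewrite lee_fin => xM; case: ifPn => [_|]; first by rewrite gt0_mulNye// leNye.
rewrite -ltNge => x0; rewrite -EFinM lee_fin ler_pdivrMr//.
by apply: le_trans Mt; rewrite ler_ln.
Qed.

Lemma lne_div_ge (x : \bar R) (M c t : R) : (0 < c)%R -> (0 < M)%R ->
  M%:E <= x -> (t * c <= ln M)%R -> t%:E <= lne x / c%:E.
Proof.
move=> c0 M0 xM Mt; rewrite inver gt_eqF//.
have ci0 : 0 < (c^-1)%:E by rewrite lte_fin invr_gt0.
case: x xM => [x|_|//] /=; last by rewrite gt0_mulye// leey.
rewrite lee_fin => xM; have x0 := lt_le_trans M0 xM.
have -> : (x <= 0)%R = false by apply/negbTE; rewrite -ltNge.
rewrite -EFinM lee_fin ler_pdivlMr//.
by apply: (le_trans Mt); rewrite ler_ln.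
Qed.

Lemma lne_div_lt (x : \bar R) (c t : R) : (0 < c)%R ->
  lne x / c%:E < t%:E -> x < (expR (t * c))%:E.
Proof.
move=> c0; rewrite !ltNge; apply: contra => /lne_div_ge; apply => //.
  exact: expR_gt0.
by rewrite expRK.
Qed.

Lemma limf_einf_le (f : R -> \bar R) (F : set_system R) (k : R) :
  (forall V e, F V -> (0 < e)%R -> exists2 d, V d & f d <= (k + e)%:E) ->
  limf_einf f F <= k%:E.
Proof.
move=> fk; rewrite limf_einfE; apply: ge_ereal_sup => _ [V FV <-].
apply/lee_addgt0Pr => e e0; have [d Vd fd] := fk V e FV e0.
by apply: le_trans fd; apply: ereal_inf_lbound; exists d.
Qed.

Lemma limf_esup_ge (f : R -> \bar R) (F : set_system R) (k : R) :
  (forall V e, F V -> (0 < e)%R -> exists2 d, V d & (k - e)%:E <= f d) ->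
  k%:E <= limf_esup f F.
Proof.
move=> fk; apply: le_ereal_inf_tmp => _ [V FV <-].
apply/lee_subgt0Pr => e e0; have [d Vd fd] := fk V e FV e0.
by apply: (le_trans fd); apply: ereal_sup_ubound; exists d.
Qed.

Lemma limf_esup_le (f : R -> \bar R) (F : set_system R) (k : R) :
  (forall e, (0 < e)%R -> \forall d \near F, f d <= (k + e)%:E) ->
  limf_esup f F <= k%:E.
Proof.
move=> fk; apply/lee_addgt0Pr => e e0.
apply: (@le_trans _ _ (ereal_sup (f @` [set d | f d <= (k + e)%:E]))).
  by apply: ereal_inf_lbound; exists [set d | f d <= (k + e)%:E] => //; exact: fk.
by apply: ge_ereal_sup => _ [d fd <-].
Qed.

Lemma limf_einf_lt (f : R -> \bar R) (F : set_system R) (k : \bar R) V :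
  limf_einf f F < k -> F V -> exists2 d, V d & f d < k.
Proof.
rewrite limf_einfE => fk FV.
have /ereal_inf_lt[_ [d Vd <-] fd] : ereal_inf (f @` V) < k.
  by apply: le_lt_trans fk; apply: ereal_sup_ubound; exists V.
by exists d.
Qed.

Lemma right0_interval (e : R) : (0 < e)%R -> \forall d \near 0%R^'+, (0 < d < e)%R.
Proof.
move=> e0; near=> d; apply/andP; split; near: d.
  exact: nbhs_right_gt.
exact: nbhs_right_lt.
Unshelve. all: by end_near. Qed.

Lemma right0_nbhsP (V : set R) : nbhs 0%R^'+ V ->
  exists2 e : R, (0 < e)%R & forall d : R, (0 < d < e)%R -> V d.
Proof.
move=> [e /= e0 eV]; exists e => // d /andP[d0 de]; apply: eV => //=.
by rewrite sub0r normrN gtr0_norm.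
Qed.

Variable n : nat.
Implicit Types A : set 'rV[R]_n.

Lemma cover_number_ge1 A d : A !=set0 -> 1%:E <= cover_number d A.
Proof.
move=> [x Ax]; apply: (@le_trans _ _ #|{: unit}|%:R%:E); first by rewrite card_unit.
by apply: (cover_number_ge (u := fun _ : unit => x)) => // -[] [].
Qed.

Lemma lower_dimB_le A k : (0 < n)%N -> (forall m, small_cover k m A) ->
  lower_dimB A <= k%:R%:E.
Proof.
move=> n0 Ak; apply: limf_einf_le => V e /right0_nbhsP[c c0 cV] e0.
(* This puts [1 / (m + 1)] below [e], the allowed loss in dimension, and below [c], so that the
   scale [K ^ - (m + 1)] is below [c] too. *)
pose m := Num.trunc (e^-1 + c^-1)%R.
have [K [s [K2 sK sA]]] := Ak m.
have K0 : (0 < K%:R :> R)%R by rewrite ltr0n (ltn_trans _ K2).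
have Km0 : (0 < K%:R ^+ m.+1 :> R)%R by rewrite exprn_gt0.
have h1 : (e^-1 + c^-1 < m.+1%:R)%R.
  have /truncn_itv/andP[] // : (0 <= e^-1 + c^-1 :> R)%R.
  by rewrite addr_ge0// invr_ge0 ltW.
have ei0 : (0 < e^-1)%R by rewrite invr_gt0.
have ci0 : (0 < c^-1)%R by rewrite invr_gt0.
have m0 : (0 < m.+1%:R :> R)%R by [].
exists (K%:R ^+ m.+1)^-1%R.
  apply: cV; rewrite invr_gt0 Km0/= invf_plt//.
  apply: (@lt_trans _ _ m.+1%:R); first lra.
  by rewrite -natrX ltr_nat ltn_expl.
rewrite lnV ?posrE// opprK lnXn//.
have lnK : (0 < ln K%:R :> R)%R by rewrite ln_gt0// ltr1n.
apply: (@lne_div_le _ (K ^ (k * m.+1 + 1))%:R).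
- by rewrite pmulrn_lgt0.
- by rewrite ltr0n expn_gt0 (ltn_trans _ K2).
- apply: (@le_trans _ _ (size s)%:R%:E); last by rewrite lee_fin ler_nat.
  apply: (cover_number_le (r := (4 * n%:R * K%:R ^+ m.+1)^-1%R)) => //.
    by rewrite invr_gt0 !mulr_gt0// ltr0n.
  rewrite le_eqVlt; apply/orP; left; apply/eqP; field.
  by rewrite pnatr_eq0 -lt0n n0 gt_eqF// ltr0n (ltn_trans _ K2).
have em : (1 <= e * m.+1%:R)%R by rewrite -ler_pdivrMl// mulr1 ltW//; lra.
rewrite natrX lnXn// -2!(mulr_natr (ln K%:R)) natrD natrM.
rewrite (_ : (_ + e) * _ = ln K%:R * (k%:R * m.+1%:R + e * m.+1%:R))%R.
  by apply: ler_wpM2l; [exact: ltW|exact: lerD].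
by ring.
Qed.

Lemma upper_dimB_le A k : (0 < n)%N -> grid_covered k A ->
  upper_dimB A <= k%:R%:E.
Proof.
move=> n0 [C CP]; apply: limf_esup_le => e e0.
pose D : R := (4 * n%:R * C.+1%:R)%R.
have D0 : (0 < D)%R by rewrite !mulr_gt0// ltr0n.
pose C' := (C.+1%:R * (D + 1) ^+ k)%R.
have C'0 : (0 < C')%R by rewrite mulr_gt0// exprn_gt0// ltr_wpDl// ltW.
(* The bound 1 makes [- ln d] positive; the other makes the constant [C'] cost at most [e] in
   dimension. *)
pose d1 := Num.min 1%R (expR (- (ln C' / e))).
have d10 : (0 < d1)%R by rewrite lt_min ltr01 expR_gt0.
apply: filterS (right0_interval d10) => d /andP[d0]; rewrite lt_min => /andP[d1' dC].
have lnd : (0 < - ln d)%R by rewrite oppr_gt0 ln_lt0// d0.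
have lnC : (ln C' <= e * - ln d)%R.
  rewrite -ler_pdivrMl// mulrC lerNr -[leRHS]expRK ltW// ltr_ln ?posrE//.
  exact: expR_gt0.
pose M := (Num.trunc (D / d)).+1.
have Dd0 : (0 <= D / d)%R by rewrite divr_ge0// ltW.
have /andP[M1 M2] := truncn_itv Dd0.
have [s [sC sA]] := CP M isT.
have M0 : (0 < M%:R :> R)%R by rewrite ltr0n.
apply: (@lne_div_le _ (C' * d^-1 ^+ k)) => //.
- by rewrite mulr_gt0// exprn_gt0// invr_gt0.
- apply: (@le_trans _ _ (size s)%:R%:E).
    apply: (cover_number_le (r := (C.+1%:R / M%:R)%R)) => //.
      by rewrite divr_gt0.
      rewrite (_ : (_ * _ = D / M%:R)%R); last by rewrite /D; field; rewrite gt_eqF.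
      by rewrite ler_pdivrMr// mulrC -ler_pdivrMr// ltW.
    move=> x /sA[c cs xc]; exists c => //; apply: (le_trans xc).
    by rewrite ler_pM2r ?invr_gt0// ler_nat.
  rewrite lee_fin; apply: (@le_trans _ _ (C * M ^ k)%:R); first by rewrite ler_nat.
  rewrite natrM natrX /C' -mulrA -exprMn; apply: ler_pM; rewrite ?exprn_ge0 ?ler_nat//.
  apply: lerXn2r; rewrite ?nnegrE ?mulr_ge0 ?invr_ge0 ?addr_ge0 ?(ltW d0) ?(ltW D0)//.
  rewrite -natr1 mulrDl mul1r; apply: lerD => //.
  by rewrite invf_ge1// ltW.
rewrite lnM ?posrE//; last by rewrite exprn_gt0// invr_gt0.
rewrite lnXn ?invr_gt0// lnV ?posrE// -(mulr_natl (- ln d)) mulrDl.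
by rewrite (addrC (ln C')) lerD2l.
Qed.

End dimension_estimates.

(** * Hausdorff dimension *)

Section Hausdorff.
Variables (R : realType) (n : nat).
Implicit Types A : set 'rV[R]_n.
Local Open Scope ereal_scope.

Lemma diam_ge0 A : 0 <= diam A.
Proof. by apply: ereal_sup_ubound; left. Qed.

Lemma Hausdorff_premeasure_ge0 s d A : 0 <= Hausdorff_premeasure s d A.
Proof.
apply: le_ereal_inf_tmp => _ [U _ <-].
by apply: nneseries_ge0 => i _ _; exact: poweR_ge0.
Qed.

Lemma dimH_ge0 A : 0 <= dimH A.
Proof.
by apply: le_ereal_inf_tmp => _ [s [s0 _] <-]; rewrite lee_fin ltW.
Qed.

(** With [y] the lower box dimension, arbitrarily small [d] admit covers by fewer than
    [d ^ - (y + e / 2)] sets of diameter at most [d]; their sum with exponent [y + e] is at most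
    [d ^ (e / 2)]. *)
Lemma dimH_le_lower_dimB A : A !=set0 -> dimH A <= lower_dimB A.
Proof.
move=> A0; have ldim0 : 0 <= lower_dimB A.
  rewrite /lower_dimB limf_einfE.
  apply: (@le_trans _ _ (ereal_inf ((fun d : R => lne (cover_number d A) /
      (- ln d)%:E) @` [set d | (0 < d < 1)%R]))); last first.
    by apply: ereal_sup_ubound; exists [set d : R | (0 < d < 1)%R] => //; exact: right0_interval.
  apply: le_ereal_inf_tmp => _ [d /andP[d0 d1] <-].
  apply: (lne_div_ge (M := 1%R)) => //; first by rewrite oppr_gt0 ln_lt0// d0.
    exact: cover_number_ge1.
  by rewrite mul0r ln1.
case E : (lower_dimB A) => [y| |]; last 2 first.
- by rewrite leey.
- by move: ldim0; rewrite E.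
move: ldim0; rewrite E lee_fin => y0; apply/lee_addgt0Pr => e e0.
rewrite -EFinD; apply: ereal_inf_lbound; exists (y + e)%R => //=.
split; first by rewrite ltr_wpDl.
set s := (y + e)%R; have s0 : (0 < s)%R by rewrite ltr_wpDl.
have e20 : (0 < e / 2)%R by rewrite divr_gt0.
apply/eqP; rewrite eq_le; apply/andP; split; last first.
  apply: (le_trans (Hausdorff_premeasure_ge0 s 1 A)).
  by apply: ereal_sup_ubound; exists 1%R => //; exact: ltr01.
apply: ge_ereal_sup => _ [d0 /= d00 <-]; apply/lee_addgt0Pr => eta eta0.
(* The last bound gives [d ^ (e / 2) <= eta]. *)
rewrite add0e; pose d1 := Num.min (Num.min d0 1%R) (expR (ln eta / (e / 2))).
have d10 : (0 < d1)%R by rewrite !lt_min d00 ltr01 expR_gt0.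
have [d] : exists2 d : R, (0 < d < d1)%R &
    lne (cover_number d A) / (- ln d)%:E < (y + e / 2)%:E.
  apply: (@limf_einf_lt R (fun d => lne (cover_number d A) / (- ln d)%:E) 0%R^'+).
    by rewrite -/(lower_dimB A) E lte_fin ltrDl.
  exact: right0_interval.
rewrite !lt_min => /andP[d_gt0 /andP[/andP[dd0 d_lt1] deta]].
have lnd : (0 < - ln d)%R by rewrite oppr_gt0 ln_lt0// d_gt0.
move=> /(lne_div_lt lnd)/ereal_inf_lt[_ [m [U [oU Ud AU]] <-]]; rewrite lte_fin => mlt.
(* The finite cover is continued by empty sets, which contribute 0 since [s] is positive. *)
pose V i := if insub i is Some j then U j else set0 : set 'rV[R]_n.
have diam0 : diam (set0 : set 'rV[R]_n) = 0.
  apply/eqP; rewrite eq_le diam_ge0 andbT; apply: ge_ereal_sup.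
  by move=> z [->|[x [y' [Fx _ _]]]]; [|case: Fx].
have Vd i : diam (V i) <= d%:E.
  by rewrite /V; case: insub => [j|] //; rewrite diam0 lee_fin ltW.
apply: (@le_trans _ _ (\sum_(0 <= i <oo) (diam (V i)) `^ s)).
  apply: ereal_inf_lbound; exists V => //; split => [i|].
    by apply: (le_trans (Vd i)); rewrite lee_fin ltW.
  move=> x /AU[j _ Ux]; exists (j : nat) => //.
  by have -> : V j = U j by rewrite /V valK.
rewrite (@nneseries_split _ _ 0 m) => [|i _]; last exact: poweR_ge0.
rewrite eseries0 ?adde0 => [|i mi _]; last first.
  by rewrite /V insubF ?diam0 ?poweR0r ?gt_eqF//; apply/negbTE; rewrite -leqNgt.
apply: (@le_trans _ _ (\sum_(0 <= i < 0 + m) (d `^ s)%:E)).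
  apply: lee_sum => i _; rewrite -poweR_EFin; apply: gt0_ler_poweR => //.
  - exact: ltW.
  - by rewrite in_itv/= diam_ge0 leey.
  - by rewrite in_itv/= lee_fin ltW// leey.
rewrite sumEFin lee_fin sumr_const_nat add0n subn0 -mulr_natl.
rewrite (_ : d `^ s = expR (s * ln d))%R; last by rewrite /powR gt_eqF.
apply: (@le_trans _ _ (expR ((y + e / 2) * - ln d) * expR (s * ln d))%R).
  by apply: ler_wpM2r; [exact: expR_ge0|exact: ltW].
rewrite -expRD (_ : (_ + _ = e / 2 * ln d)%R); last by rewrite /s; field.
rewrite -[leRHS]lnK ?posrE// ler_expR mulrC -ler_pdivlMr//.
by rewrite -[leRHS]expRK ler_ln ?posrE ?expR_gt0// ltW.
Qed.

(* Each set of a Hausdorff cover is put into an open box; the terms eps i make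
   the boxes open without spoiling the sum. *)
Lemma Hausdorff_boxes (X : metricType R) (f : X -> 'rV[R]_n) d (eta : R) :
  compact [set: X] -> continuous f -> dimH (range f) < d.+1%:R%:E ->
  (0 < eta)%R -> exists l : seq ('rV[R]_n * R),
    [/\ forall p, p \in l -> (0 < p.2)%R,
        forall x, exists2 p, p \in l & (`|f x - p.1| < p.2)%R &
        (\sum_(p <- l) p.2 ^+ d.+1 <= eta)%R].
Proof.
move=> cX cf; move=> /ereal_inf_lt[_ [s [s0 Hs] <-]]; rewrite lte_fin => sd eta0.
(* [k] is the cost of the factor 2 in [r] below; [mu] will bound both the Hausdorff sum and the sum
   of the [eps i]. *)
pose k : R := (2 ^+ d.+1)%R; have k0 : (0 < k)%R by rewrite exprn_gt0.
pose mu := Num.min 1%R (eta / (2 * k))%R.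
have mu0 : (0 < mu)%R by rewrite lt_min ltr01 divr_gt0// mulr_gt0.
have : Hausdorff_premeasure s 1 (range f) < mu%:E.
  apply: (@le_lt_trans _ _ 0); last by rewrite lte_fin.
  by rewrite -Hs; apply: ereal_sup_ubound; exists 1%R => //=; exact: ltr01.
move=> /ereal_inf_lt[_ [U [Ud fU] <-]] Umu.
pose rho i := fine (diam (U i)).
have diamE i : diam (U i) = (rho i)%:E.
  rewrite /rho fineK// ge0_fin_numE ?diam_ge0//.
  by apply: (le_lt_trans (Ud i)); rewrite ltry.
have rho0 i : (0 <= rho i)%R by rewrite -lee_fin -diamE diam_ge0.
have rho1 i : (rho i <= 1)%R by rewrite -lee_fin -diamE.
pose eps i : R := (mu * 2^-1 ^+ i.+1)%R.
have eps0 i : (0 < eps i)%R by rewrite mulr_gt0// exprn_gt0// invr_gt0.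
have eps1 i : (eps i <= 1)%R.
  rewrite /eps mulr_ile1 ?exprn_ge0 ?(ltW mu0) ?invr_ge0//.
    by rewrite ge_min lexx.
  by rewrite exprn_ile1 ?invr_ge0// invf_le1// ler1n.
(* Doubling makes [r i] strictly larger than [rho i], so that a box contains a neighbourhood of each
   point of [U i]. *)
pose r i : R := (2 * Num.max (rho i) (eps i))%R.
have r_rho i : (rho i < r i)%R.
  rewrite /r; have := eps0 i; have := rho0 i.
  by rewrite maxEle; case: ifPn; rewrite -?ltNge; lra.
have r0 i : (0 < r i)%R by rewrite (le_lt_trans (rho0 i)).
have /choice[c cP] : forall i, exists c, forall z, U i z -> (`|z - c| <= rho i)%R.
  move=> i; have [[c Uc]|nU] := pselect (exists c, U i c); last first.
    by exists 0%R => z Uz; exfalso; apply: nU; exists z.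
  exists c => z Uz; apply: (le_trans (edist_norm _ _)); rewrite -lee_fin -diamE.
  by apply: ereal_sup_ubound; right; exists z, c.
have /choice[ix ixP] : forall x, exists i, U i (f x).
  by move=> x; have [|i _ Ui] := fU (f x); [exists x|exists i].
have nU x : nbhs x [set y | (`|f y - c (ix x)| < r (ix x))%R].
  have e0 : (0 < r (ix x) - rho (ix x))%R by rewrite subr_gt0.
  apply: filterS (continuous_nbhs x cf e0) => y /=.
  rewrite distrC => fxy; rewrite -(subrKA (f x)).
  apply: (le_lt_trans (ler_normD _ _)); have := cP _ _ (ixP x); lra.
have [t tP] := finite_net cX nU.
pose N := (\max_(x <- t) (ix x).+1)%N.
exists [seq (c i, r i) | i <- iota 0 N]; split.
- by move=> _ /mapP[i _ ->]; exact: r0.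
- move=> x; have [q qt qx] := tP x; exists (c (ix q), r (ix q)) => //.
  apply/mapP; exists (ix q) => //; rewrite mem_iota/= add0n.
  exact: (@leq_bigmax_seq _ t xpredT (fun x => (ix x).+1) q qt isT).
rewrite big_map /=.
apply: (@le_trans _ _ (\sum_(i <- iota 0 N) k * (rho i `^ s + eps i))%R).
  apply: ler_sum => i _; rewrite /r exprMn -/k ler_wpM2l ?(ltW k0)//.
  apply: (@le_trans _ _ (rho i ^+ d.+1 + eps i)%R).
    have h1 : (eps i ^+ d.+1 <= eps i)%R.
      by rewrite exprS ler_piMr ?(ltW (eps0 i))// exprn_ile1// ltW.
    have h2 : (0 <= rho i ^+ d.+1)%R by rewrite exprn_ge0.
    have h3 := eps0 i.
    by rewrite maxEle; case: ifP => _; lra.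
  rewrite lerD2r -powR_mulrn//.
  have [->|rn0] := eqVneq (rho i) 0%R; first by rewrite !powR0 ?gt_eqF// pnatr_eq0.
  apply: ger_powR; last exact: ltW.
  by rewrite rho1 lt_def rn0 rho0.
rewrite -mulr_sumr big_split/=.
have h1 : (\sum_(i <- iota 0 N) rho i `^ s <= mu)%R.
  rewrite -lee_fin; apply: le_trans (ltW Umu).
  rewrite -sumEFin (_ : \sum_(i <- iota 0 N) _ = \sum_(0 <= i < N) (diam (U i)) `^ s).
    by apply: nneseries_lim_ge => i _ _; exact: poweR_ge0.
  rewrite /index_iota subn0; apply: eq_bigr => i _.
  by rewrite diamE poweR_EFin.
have h2 : (\sum_(i <- iota 0 N) eps i <= mu)%R.
  rewrite -mulr_sumr ler_piMr ?(ltW mu0)//.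
  suff -> : (\sum_(i <- iota 0 N) 2^-1 ^+ i.+1 = 1 - 2^-1 ^+ N :> R)%R.
    by rewrite gerBl exprn_ge0// invr_ge0.
  rewrite -[N in iota 0 N]subn0 -/(index_iota 0 N).
  elim: (N) => [|j IH]; first by rewrite big_nil expr0 subrr.
  by rewrite big_nat_recr//= IH !exprS; field.
have h3 : (k * mu <= eta / 2)%R.
  apply: (@le_trans _ _ (k * (eta / (2 * k)))%R).
    by rewrite ler_wpM2l ?(ltW k0)// ge_min lexx orbT.
  by rewrite le_eqVlt; apply/orP; left; apply/eqP; field; rewrite gt_eqF.
apply: (@le_trans _ _ (k * (mu + mu))%R).
  by rewrite ler_wpM2l ?(ltW k0)// lerD.
by rewrite mulrDr; lra.
Qed.

End Hausdorff.

(** * Szpilrajn's inequality *)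

Section Szpilrajn.
Variable R : realType.

(** Subtracting the least such integer sends them injectively into the integers from 0 to
    [2 * w]. *)
Lemma card_near_nat (M : nat) (u w : R) : 0 <= w ->
  #|[pred t : 'I_M | `|u - t%:R| <= w]|%:R <= 2 * w + 1.
Proof.
move=> w0; have w20 : 0 <= 2 * w by rewrite mulr_ge0.
set P := [pred t : 'I_M | _].
have [t1 Pt1|P0] := pickP P; last by rewrite eq_card0// ltW// ltr_wpDl.
have [t0 Pt0 t0min] := arg_minnP (fun t : 'I_M => t : nat) Pt1.
have /andP[h1 _] := truncn_itv w20.
apply: (@le_trans _ _ (Num.trunc (2 * w)).+1%:R); last by rewrite -natr1 lerD2r.
rewrite ler_nat -[leqRHS]card_ord.
rewrite -(@card_in_image _ _ (fun t : 'I_M => inord (t - t0) : 'I_(Num.trunc (2 * w)).+1)).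
  exact: max_card.
have tt0 t : P t -> (t0 <= t)%N /\ (t - t0 < (Num.trunc (2 * w)).+1)%N.
  move=> Pt; have t0t := t0min t Pt; split => //; rewrite ltnS truncn_ge_nat// natrB//.
  have : `|u - t%:R| <= w := Pt; have : `|u - t0%:R| <= w := Pt0.
  by rewrite !ler_distlC => /andP[? ?] /andP[? ?]; lra.
move=> t t' Pt Pt' /(congr1 val); have [t1' t2] := tt0 t Pt; have [t3 t4] := tt0 t' Pt'.
rewrite /= !inordK// => tt'; apply/val_inj => /=.
by rewrite -(subnK t1') tt' subnK.
Qed.

Lemma sum_le_exists (M : nat) (S : 'I_M -> R) (c : R) : (0 < M)%N ->
  \sum_t S t <= M%:R * c -> exists t, S t <= c.
Proof.
move=> M0 Sc; apply: contrapT => /forallNP nS.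
have : \sum_(t < M) c < \sum_t S t.
  apply: ltr_sum => [|t _]; last by rewrite ltNge; apply/negP; exact: nS.
  by apply/hasP; exists (Ordinal M0) => //; rewrite mem_index_enum.
by rewrite sumr_const card_ord -mulr_natl ltNge Sc.
Qed.

Variables (n B : nat) (d : R).
Hypothesis d_gt0 : 0 < d.

(** A pair stands for the cube with that centre and half-side; it is hit when it meets one of the
    [n * B] walls of the grid with origin [a]. *)
Definition hits (a : R) (p : 'rV[R]_n * R) :=
  [exists j : 'I_n * 'I_B, `|p.1 ord0 j.1 - (a + d * j.2%:R)| <= p.2].

(** Among finely spaced translates, a given wall meets a box of half-side [w] for a fraction of at
    most [3 * w / d]; [C] adds this up over the walls. *)
Let C : R := #|{: 'I_n * 'I_B}|%:R * (3 / d).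

(* Averaging over a fine set of translates: the box p is hit with frequency of
   order p.2, so that some translate hits boxes of small total weight. *)
Lemma translate_hits_few (l : seq ('rV[R]_n * R)) (e : nat) (lo : R) :
  (forall p, p \in l -> 0 < p.2) -> exists a, [/\ lo <= a, a < lo + d &
    \sum_(p <- l | hits a p) p.2 ^+ e <= C * \sum_(p <- l) p.2 ^+ e.+1].
Proof.
(* The spacing [d / M] is at most every half-side, so that the count [2 * w + 1] below is at most
   [3 * w]. *)
move=> l0; pose M := (\max_(p <- l) (Num.trunc (d / p.2)).+1).+1.
have Mgt0 : 0 < M%:R :> R by rewrite ltr0n.
pose a (t : 'I_M) := lo + d * t%:R / M%:R.
have [||t aP] := @sum_le_exists M
  (fun t => \sum_(p <- l | hits (a t) p) p.2 ^+ e)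
  (C * \sum_(p <- l) p.2 ^+ e.+1); last first.
- exists (a t); split => //; rewrite /a.
    by rewrite lerDl divr_ge0// mulr_ge0// ltW.
  by rewrite ltrD2l ltr_pdivrMr// ltr_pM2l// ltr_nat.
- under eq_bigr do rewrite big_mkcond/=.
  rewrite exchange_big/= !mulr_sumr big_seq [leRHS]big_seq; apply: ler_sum => p pl.
  have p0 := l0 p pl.
  rewrite -big_mkcond/= sumr_const -[leLHS]mulr_natl.
  have Mp : 1 <= p.2 * M%:R / d.
    rewrite ler_pdivlMr// mul1r mulrC -ler_pdivrMr// ltW//.
    have /truncn_itv/andP[_ h] : 0 <= d / p.2 by rewrite divr_ge0// ltW.
    apply: (lt_le_trans h); rewrite ler_nat ltnW// ltnS.
    exact: (@leq_bigmax_seq _ l xpredT (fun p => (Num.trunc (d / p.2)).+1) p pl isT).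
  rewrite exprS (_ : M%:R * (C * (p.2 * p.2 ^+ e)) = M%:R * (C * p.2) * p.2 ^+ e);
    last by ring.
  rewrite ler_pM2r ?exprn_gt0//.
  pose w := p.2 * M%:R / d.
  apply: (@le_trans _ _ (\sum_(j : 'I_n * 'I_B) (2 * w + 1))); last first.
    rewrite sumr_const -[leLHS]mulr_natl (_ : _ * (C * _) = #|{: 'I_n * 'I_B}|%:R * (3 * w)).
      by rewrite ler_wpM2l//; rewrite /w; lra.
    by rewrite /C /w; field; rewrite gt_eqF.
  apply: (@le_trans _ _ (\sum_(j : 'I_n * 'I_B) #|[pred t : 'I_M |
      `|p.1 ord0 j.1 - (a t + d * j.2%:R)| <= p.2]|%:R)).
    rewrite -natr_sum ler_nat; under [leqRHS]eq_bigr do rewrite -sum1_card.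
    rewrite -sum1_card big_mkcond/=.
    under [leqRHS]eq_bigr do rewrite big_mkcond/=.
    rewrite exchange_big/=; apply: leq_sum => t _.
    case: ifPn => // /existsP[j hj]; rewrite (bigD1 j)//= ifT ?leq_addr//.
  apply: ler_sum => j _; apply: le_trans (card_near_nat M
    ((p.1 ord0 j.1 - lo - d * j.2%:R) * M%:R / d) _); last first.
    by rewrite /w; lra.
  rewrite ler_nat; apply/subset_leq_card/fintype.subsetP => t; rewrite !inE => ht.
  rewrite /w (_ : _ - t%:R = (p.1 ord0 j.1 - (a t + d * j.2%:R)) * (M%:R / d)).
    have Md : 0 < M%:R / d by rewrite divr_gt0.
    by rewrite normrM (gtr0_norm Md) -mulrA ler_pM2r.
  by rewrite /a; field; rewrite !gt_eqF.
- by [].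
Qed.

(** Each translate leaves only the boxes it hits, whose weight with exponent lowered by one is at
    most [C] times the old weight. At exponent 0 the weight counts boxes, and a count below 1 leaves
    none. *)
Lemma translates_avoid (m : nat) (l : seq ('rV[R]_n * R)) (lo : R) :
  (forall p, p \in l -> 0 < p.2) -> C ^+ m * \sum_(p <- l) p.2 ^+ m < 1 ->
  exists a : 'I_m -> R, (forall j, lo <= a j < lo + d) /\
    forall p, p \in l -> exists j, ~~ hits (a j) p.
Proof.
have C0 : 0 <= C by rewrite mulr_ge0// divr_ge0// ltW.
elim: m l => [|m IH] l l0 lC.
  exists (fun=> 0); split => [[]//|p pl]; exfalso; move: lC.
  rewrite expr0 mul1r (eq_bigr (fun=> 1)) => [|q _]; last by rewrite expr0.
  rewrite big_const_seq count_predT iter_addr_0 -[X in _ < X]/(1%:R) ltr_nat.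
  by case: l pl {l0}.
have [a [loa alo al]] := translate_hits_few m lo l0.
have [||b [blo bP]] := IH [seq p <- l | hits a p].
- by move=> p; rewrite mem_filter => /andP[_ /l0].
- rewrite big_filter; apply: le_lt_trans lC; rewrite exprSr -mulrA.
  by apply: ler_wpM2l => //; exact: exprn_ge0.
exists (fun j => oapp b a (unlift ord0 j)); split => [j|p pl].
  by case: unliftP => [k _|_] /=; [exact: blo|rewrite loa].
have [pa|pa] := boolP (hits a p); last by exists ord0; rewrite unlift_none.
have [|j bj] := bP p; first by rewrite mem_filter pa.
by exists (lift ord0 j); rewrite liftK.
Qed.

End Szpilrajn.

(** The image is covered by boxes of small total weight, and [d.+1] grids are placed so that each
    box avoids the walls of one of them. The side of the cells is a Lebesgue number of the cover. *)
Lemma covering_dim_le_Hausdorff (R : realType) (X : metricType R) n d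
    (f : X -> 'rV[R]_n) : compact [set: X] -> [set: X] !=set0 ->
  continuous f -> (dimH (range f) < d.+1%:R%:E)%E -> covering_dim_le (range f) d.
Proof.
move=> cX [x0 _] cf fd p U oU Ucov.
have fin x : f x \in range f by apply/mem_set; exists x.
pose F x : range f := exist _ (f x) (fin x).
have [e e0 eU] : exists2 e, 0 < e & forall x, exists i, forall y,
    `|f x - f y| < e -> U i (F y).
  apply: (@lebesgue_number R X (fun x y => `|f x - f y|) p
      (fun i => F @^-1` U i)) => // [x y z|x r r0|x].
  - by rewrite -(subrKA (f y)) ler_normD.
  - exact: continuous_nbhs.
  have [i _ Ux] : (\bigcup_i U i) (F x) by rewrite Ucov.
  exists i; have [Q oQ QU] := oU i.
  have Qx : Q (f x) by move: Ux; rewrite -QU.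
  have /nbhs_ballP[r /= r0 rQ] : nbhs (f x) Q by exact: open_nbhs_nbhs.
  exists r => // y xy; rewrite /preimage /= -QU; apply: rQ.
  by rewrite -ball_normE; exact: xy.
have [M M0 fM] := compact_range_bounded cX cf.
(* The grid origins will lie between [- M - e] and [- M], so [B] steps of length [e] lead past
   [M]. *)
pose B := (Num.trunc ((2 * M + e) / e)).+1.
have eB : 2 * M + e < e * B%:R.
  have /truncn_itv/andP[_ ] : 0 <= (2 * M + e) / e.
    by rewrite divr_ge0 ?(ltW e0)// addr_ge0 ?(ltW e0)// mulr_ge0// ltW.
  by rewrite ltr_pdivrMr// (mulrC e).
pose C : R := #|{: 'I_n * 'I_B}|%:R * (3 / e).
have C0 : 0 <= C by rewrite mulr_ge0// divr_ge0// ltW.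
have eta0 : 0 < (C ^+ d.+1 + 1)^-1 by rewrite invr_gt0 ltr_wpDl// exprn_ge0.
have [l [l0 lf lC]] := Hausdorff_boxes cX cf fd eta0.
have [|a [alo aP]] := @translates_avoid R n B e e0 d.+1 l (- M - e) l0.
  apply: (@le_lt_trans _ _ (C ^+ d.+1 * (C ^+ d.+1 + 1)^-1)).
    by apply: ler_wpM2l => //; exact: exprn_ge0.
  by rewrite ltr_pdivrMr ?mul1r ?ltrDl// ltr_wpDl// exprn_ge0.
have imF (z : range f) : exists x, z = F x.
  by have /set_mem[x _ xz] := valP z; exists x; apply: val_inj.
apply: (@grid_cover R (range f) n d.+1 B p
  (fun i z => (set_val z : 'rV[R]_n) ord0 i) a e U (F x0)) => //.
- by move=> i; apply: continuous_coord; exact: initial_continuous.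
- move=> j i z; have [x ->] := imF z; have /andP[a1 a2] := alo j.
  have := le_trans (coord_norm_le (f x) i) (fM x); rewrite ler_norml.
  move: eB; rewrite /F set_valE /=; move: (e * _) => eB ? /andP[? ?].
  by apply/andP; split; lra.
- move=> z; have [x ->] := imF z; have [q ql xq] := lf x.
  have [j qj] := aP q ql; exists j => i k; apply/eqP => fxi.
  move/negP: qj; apply; apply/existsP; exists (i, k) => /=.
  rewrite -fxi /F set_valE /= distrC ltW//; apply: le_lt_trans xq.
  by have := coord_norm_le (f x - q.1) i; rewrite !mxE.
- move=> z; have [x ->] := imF z; have [i iU] := eU x; exists i => z'.
  have [y ->] := imF z' => xy; apply: iU; apply: row_norm_lt => // j.
  by have := xy j; rewrite /F !set_valE /= !mxE.
Qed.

(** * Packing dimension *)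

Section condensation.
Variables (R : realType) (X : metricType R).
Hypothesis compactX : compact [set: X].

Definition condensation : set X :=
  [set x | forall r, 0 < r -> ~ countable [set y | mdist x y < r]].

(** A point with a countable neighbourhood lies in a countable ball of radius [1 / (m + 1)] about a
    point of a finite net, and there are countably many such balls. *)
Lemma countable_not_condensation : countable (~` condensation).
Proof.
have m0 (m : nat) : 0 < m.+1%:R^-1 :> R by rewrite invr_gt0.
have /choice[s sP] : forall m : nat, exists s : seq X,
    forall y, exists2 p, p \in s & mdist p y < m.+1%:R^-1.
  by move=> m; exact: (finite_net compactX (fun p => nbhs_mdist p (m0 m))).
pose G (t : nat * nat) : set X := [set y | exists2 p, onth (s t.1) t.2 = Some p &
  countable [set z | mdist p z < t.1.+1%:R^-1] /\ mdist p y < t.1.+1%:R^-1].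
apply: (@sub_countable _ _ _ (\bigcup_t G t)); last first.
  apply: bigcup_countable; first exact: countableP.
  move=> [m i] _; case E : (onth (s m) i) => [p|]; last first.
    rewrite (_ : G _ = set0) ?countable0//; apply/seteqP; split => // y [p].
    by rewrite /= E.
  have [cp|ncp] := pselect (countable [set z | mdist p z < m.+1%:R^-1]).
    apply: sub_countable cp; apply: subset_card_le => y [q] /=.
    by rewrite E => -[->] [].
  rewrite (_ : G _ = set0) ?countable0//; apply/seteqP; split => // y [q] /=.
  by rewrite E => -[<-] [].
apply: subset_card_le => x /existsNP[r /not_implyP[r0 /contrapT cr]].
pose m := Num.trunc (2 / r).
have mr : 2 * m.+1%:R^-1 < r.
  have /truncn_itv/andP[_ h] : 0 <= 2 / r by rewrite divr_ge0// ltW.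
  by rewrite ltr_pdivrMr// mulrC -ltr_pdivrMr.
have [p ps px] := sP m x.
exists (m, index p (s m)) => //; exists p.
  by rewrite /= onthE (nth_map p) ?index_mem// nth_index.
split => //; apply: sub_countable cr; apply: subset_card_le => y /= py.
move: (metric_triangle x p y) px py mr; rewrite (metric_sym x p).
by move: (m.+1%:R^-1) => v; lra.
Qed.

Lemma infinite_condensation (A : set X) :
  ~ countable A -> infinite_set (A `&` condensation).
Proof.
move=> nA fA; apply: nA.
apply: (@sub_countable _ _ _ (\bigcup_(b : bool)
    if b then A `&` condensation else ~` condensation)).
  apply: subset_card_le => x Ax.
  by have [cx|ncx] := pselect (condensation x); [exists true|exists false].
apply: bigcup_countable; first exact: countableP.
case=> _; first exact: finite_set_countable.
exact: countable_not_condensation.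
Qed.

Lemma closed_condensation : closed condensation.
Proof.
move=> x clx r r0 cr; have r20 : 0 < r / 2 by rewrite divr_gt0.
have [y [cy /= xy]] := clx _ (nbhs_mdist x r20).
apply: (cy _ r20); apply: sub_countable cr; apply: subset_card_le => z /= yz.
by have := metric_triangle x y z; lra.
Qed.

(** Otherwise nested closed balls centred in [C] can be chosen, avoiding the sets [A i] one after
    the other; a cluster point of the centres lies in [C] and in no [A i]. *)
Lemma compact_Baire (C : set X) (A : nat -> set X) :
  closed C -> C !=set0 -> (forall i, closed (A i)) -> C `<=` \bigcup_i A i ->
  exists i x r, [/\ C x, 0 < r & forall y, C y -> mdist x y < r -> A i y].
Proof.
move=> clC [x0 Cx0] clA CA; apply: contrapT => nB.
have step i (xr : X * R) : exists yr : X * R, C xr.1 -> 0 < xr.2 ->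
    [/\ C yr.1, 0 < yr.2 & forall z, mdist yr.1 z <= yr.2 ->
      ~ A i z /\ mdist xr.1 z <= xr.2].
  have [[Cx r0]|h] := pselect (C xr.1 /\ 0 < xr.2); last first.
    by exists xr => Cx r0; exfalso; exact: h.
  have [y [Cy xy nAy]] : exists y, [/\ C y, mdist xr.1 y < xr.2 & ~ A i y].
    apply: contrapT => ny; apply: nB; exists i, xr.1, xr.2; split => // y Cy xy.
    by apply: contrapT => nAy; apply: ny; exists y.
  have /nbhs_ballP[t /= t0 tA] : nbhs y (~` A i).
    by apply: open_nbhs_nbhs; split => //; exact: closed_openC.
  pose r' := Num.min (t / 2) (xr.2 - mdist xr.1 y).
  have r'0 : 0 < r' by rewrite lt_min divr_gt0// subr_gt0.
  exists (y, r') => _ _; split => // z /=; rewrite le_min => /andP[z1 z2]; split.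
    by apply: tA; rewrite ballEmdist /=; lra.
  by have := metric_triangle xr.1 y z; lra.
have /choice[S SP] : forall i, exists S : X * R -> X * R, forall xr,
    C xr.1 -> 0 < xr.2 -> [/\ C (S xr).1, 0 < (S xr).2 &
      forall z, mdist (S xr).1 z <= (S xr).2 -> ~ A i z /\ mdist xr.1 z <= xr.2].
  by move=> i; have /choice[S SP] := step i; exists S.
pose u := fix u i := if i is j.+1 then S j (u j) else (x0, 1).
have uP i : C (u i).1 /\ 0 < (u i).2.
  elim: i => [|i [Cu u0]]; first by split; [|exact: ltr01].
  by have [] := SP i _ Cu u0.
have uS i z : mdist (u i.+1).1 z <= (u i.+1).2 ->
    ~ A i z /\ mdist (u i).1 z <= (u i).2.
  by have [_ _] := SP i _ (uP i).1 (uP i).2; exact.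
have uD i j : (i <= j)%N -> mdist (u i).1 (u j).1 <= (u i).2.
  move=> /subnKC <-; move: (j - i)%N => k; elim: k i => [|k IH] i.
    by rewrite addn0 mdistxx; exact/ltW/(uP i).2.
  by rewrite addnS -addSn; apply: (uS i _ _).2; exact: IH.
have [z [_ zu]] := compactX (F := (fun i => (u i).1) @ \oo) _ filterT.
have uF i (B : set X) : (forall j, (i <= j)%N -> B (u j).1) ->
    ((fun i => (u i).1) @ \oo) B by move=> uB; exists i.
have Cz : C z.
  by apply: clC => B Bz; apply: zu Bz; apply: (uF 0%N) => j _; exact: (uP j).1.
have zuD i : mdist (u i).1 z <= (u i).2.
  rewrite leNgt; apply/negP => h.
  have e0 : 0 < mdist (u i).1 z - (u i).2 by rewrite subr_gt0.
  have [y [/= yu yz]] := zu [set y | mdist (u i).1 y <= (u i).2] _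
    (uF i _ (uD i)) (nbhs_mdist z e0).
  by have := metric_triangle (u i).1 y z; rewrite (metric_sym y); lra.
have [i _ Aiz] := CA z Cz.
by have [] := uS i z (zuD i.+1).
Qed.

End condensation.

Section many_points.
Variables (R : realType) (X : metricType R) (n : nat).

(* The image of A contains a K^(m+1) x ... x K^(m+1) grid-like set of points at
   distance more than d = K^-(m+2), so that log N_d / - log d is at least
   n (m + 1) / (m + 2). The factor 2 leaves room for perturbations. *)
Definition many_points (m : nat) (A : set X) (f : X -> 'rV[R]_n) :=
  exists (K : nat) (u : {ffun 'I_n -> 'I_(K ^ m.+1)} -> X),
    [/\ (2 <= K)%N, forall w, A (u w) &
        forall w w', w != w' ->
          2 * (K%:R ^+ m.+2)^-1 < `|f (u w) - f (u w')|].

(** Near [p] the map is almost constant, so finitely many points of [A] there can be moved onto a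
    small cubical grid by bump functions with disjoint supports. *)
Lemma dense_interior_many_points m (A : set X) p :
  (forall r, 0 < r -> infinite_set (A `&` [set y | mdist p y < r])) ->
  dense_interior (many_points m A).
Proof.
move=> infA f e cf e0.
have e40 : 0 < e / 4 by rewrite divr_gt0.
have /nbhs_ballP[r /= r0 rf] := continuous_nbhs p cf e40.
(* The grid has spacing [e / (4 * L)], half of which is lost to perturbations of size
   [e / (16 * L)]; the rest exceeds [2 / (K * L)] because [16 < e * K]. *)
pose K := (Num.trunc (16 / e)).+2; pose L := (K ^ m.+1)%N.
have Ke : 16 < e * K%:R.
  have /truncn_itv/andP[_ h] : 0 <= 16 / e by rewrite divr_ge0// ltW.
  rewrite -ltr_pdivrMl// mulrC; apply: (lt_trans h).
  by rewrite ltr_nat.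
have L0 : 0 < L%:R :> R by rewrite ltr0n expn_gt0.
have K0 : 0 < K%:R :> R by rewrite ltr0n.
pose I := {ffun 'I_n -> 'I_L}.
have [B BA Bcard] := infinite_set_fset #|{: I}| (infA r r0).
set s := finmap.enum_fset B in Bcard.
pose u (w : I) := nth p s (enum_rank w).
have us w : u w \in s by rewrite mem_nth// (leq_trans (ltn_ord _)).
have uA w : A (u w) /\ mdist p (u w) < r by exact: (BA (u w) (us w)).
have injd w w' : w != w' -> 0 < mdist (u w) (u w').
  move=> ww'; rewrite mdist_gt0 nth_uniq ?finmap.fset_uniq//.
  - by rewrite (inj_eq val_inj) (inj_eq enum_rank_inj).
  - by rewrite (leq_trans (ltn_ord _)).
  - by rewrite (leq_trans (ltn_ord _)).
pose sep : R := \big[Num.min/1]_(t : I * I | t.1 != t.2) mdist (u t.1) (u t.2).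
have sep0 : 0 < sep.
  rewrite /sep; elim/big_ind : _ => // [a b a0 b0|t]; last exact: injd.
  by rewrite lt_min a0 b0.
have sepP w w' : w != w' -> sep <= mdist (u w) (u w').
  move=> ww'; exact: (@bigmin_le_cond _ _ _ _ (w, w')
    (fun t : I * I => t.1 != t.2) (fun t => mdist (u t.1) (u t.2)) ww').
pose chi (w : I) y : R := Num.max 0 (1 - 2 / sep * mdist (u w) y).
have cchi w : continuous (chi w).
  apply: (@continuous_max0 _ _ (fun y => 1 - 2 / sep * mdist (u w) y)) => y.
  by apply: cvgB; [exact: cvg_cst|apply: cvgMr; exact: continuous_mdist].
have chi0 w y : 0 <= chi w y by rewrite le_max lexx.
have chi1 w y : chi w y <= 1.
  by rewrite ge_max ler01 gerBl mulr_ge0// ?divr_ge0 ?mdist_ge0// ltW.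
have chi_pos w y : chi w y != 0 -> mdist (u w) y < sep / 2.
  move=> h; have : 0 < chi w y by rewrite lt_def h chi0.
  rewrite lt_max ltxx subr_gt0/= mulrAC ltr_pdivrMr// mul1r; lra.
have chi_disj w w' y : w != w' -> chi w y != 0 -> chi w' y = 0.
  move=> ww' /chi_pos h; apply/eqP; apply: contrapT => /negP /chi_pos h'.
  have := sepP _ _ ww'; have := metric_triangle (u w) y (u w').
  by rewrite (metric_sym y); lra.
have chiS y : \sum_w chi w y <= 1.
  have [[w hw]|nw] := pselect (exists w, chi w y != 0); last first.
    rewrite big1// => w _; apply/eqP; apply: contrapT => /negP h.
    by apply: nw; exists w.
  rewrite (bigD1 w)//= big1 ?addr0// => w' ww'.
  by apply: (chi_disj w) => //; rewrite eq_sym.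
pose T (w : I) : 'rV[R]_n := f p + \row_i (e / (4 * L%:R) * (w i)%:R).
have eL0 : 0 < e / (4 * L%:R) by rewrite divr_gt0// mulr_gt0.
have Tp w : `|T w - f p| <= e / 4.
  rewrite /T addrC addKr; apply: row_norm_le => [|i]; first exact: ltW.
  rewrite mxE ger0_norm; last by apply: mulr_ge0 => //; exact: ltW.
  apply: (@le_trans _ _ (e / (4 * L%:R) * L%:R)).
    by apply: ler_wpM2l; [exact: ltW|rewrite ler_nat ltnW].
  by rewrite le_eqVlt; apply/orP; left; apply/eqP; field; rewrite gt_eqF.
pose g y := f y + \sum_w chi w y *: (T w - f (u w)).
have gu : forall w, g (u w) = T w.
  move=> w; have chi1w : chi w (u w) = 1 by rewrite /chi mdistxx mulr0 subr0 max_r.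
  rewrite /g (bigD1 w)//= big1 ?addr0 => [|w' ww'].
    by rewrite chi1w scale1r addrC subrK.
  have -> : chi w' (u w) = 0; last exact: scale0r.
  by apply: (chi_disj w); [rewrite eq_sym|rewrite chi1w oner_neq0].
exists g; split.
- move=> y; apply: cvgD; first exact: cf.
  suff : continuous (fun y => \sum_w chi w y *: (T w - f (u w))) by exact.
  apply: continuous_row => i; under eq_fun do rewrite summxE.
  apply: continuous_sum => w; under eq_fun do rewrite mxE.
  by move=> z; apply: cvgMl; exact: cchi.
- move=> y; rewrite opprD addNKr normrN; apply: (le_lt_trans (ler_norm_sum _ _ _)).
  apply: (@le_lt_trans _ _ (\sum_w chi w y * (e / 2))).
    apply: ler_sum => w _; rewrite normrZ ger0_norm//; apply: ler_wpM2l => //.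
    rewrite -(subrKA (f p)); apply: (le_trans (ler_normD _ _)).
    have : `|f p - f (u w)| < e / 4 by apply: rf; rewrite ballEmdist; exact: (uA w).2.
    by have := Tp w; lra.
  rewrite -mulr_suml; apply: (@le_lt_trans _ _ (1 * (e / 2))); last lra.
  by apply: ler_wpM2r => //; rewrite divr_ge0// ltW.
have r'0 : 0 < e / (16 * L%:R) by rewrite divr_gt0// mulr_gt0.
exists (e / (16 * L%:R)) => // h ch gh; exists K, u; split => // [w|w w' ww'].
  exact: (uA w).1.
have [i wi] : exists i, w i != w' i.
  apply: contrapT => /forallNP eqw; move/eqP : ww'; apply; apply/ffunP => i.
  by have /negP/negPn/eqP := eqw i.
have TT : e / (4 * L%:R) <= `|T w - T w'|.
  apply: le_trans (coord_norm_le _ i).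
  rewrite !mxE opprD addrACA subrr add0r -mulrBr normrM (gtr0_norm eL0).
  rewrite ler_pMr// ler_normr; move: wi; rewrite -(inj_eq val_inj)/= neq_ltn.
  by case/orP; rewrite -(ler_nat R) -natr1 => ?; apply/orP; [right|left]; lra.
have h1 := gh (u w); have h2 := gh (u w'); rewrite !gu in h1 h2.
have h3 : `|T w - T w'| <= `|T w - h (u w)| + `|h (u w) - h (u w')| + `|T w' - h (u w')|.
  rewrite -[X in `|X|](subrKA (h (u w))); apply: (le_trans (ler_normD _ _)).
  rewrite -[leRHS]addrA lerD2l (distrC (T w')) -[X in `|X| <= _](subrKA (h (u w'))).
  exact: ler_normD.
have h4 : 2 * (K%:R ^+ m.+2)^-1 < e / (8 * L%:R).
  rewrite exprS -natrX -/L ltr_pdivlMr ?mulr_gt0//.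
  rewrite (_ : _ * _ * _ = 16 / K%:R); first by rewrite ltr_pdivrMr.
  by field; rewrite !gt_eqF.
have h5 : e / (4 * L%:R) = e / (8 * L%:R) + e / (16 * L%:R) + e / (16 * L%:R).
  by field; rewrite gt_eqF.
lra.
Qed.

(** Points of [F] within [d / 2] of the images are still more than [d] apart, so membership in the
    closure suffices. *)
Lemma upper_dimB_closure_many_points (F : set 'rV[R]_n) (f : X -> 'rV[R]_n) m A :
  (forall x, A x -> closure F (f x)) -> many_points m A f ->
  exists2 d, 0 < d < m.+1%:R^-1 &
    ((n%:R * m.+1%:R / m.+2%:R)%:E <= lne (cover_number d F) / (- ln d)%:E)%E.
Proof.
move=> AF [K [u [K2 uA usep]]].
have K0 : 0 < K%:R :> R by rewrite ltr0n (ltn_trans _ K2).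
pose d : R := (K%:R ^+ m.+2)^-1.
have d0 : 0 < d by rewrite invr_gt0 exprn_gt0.
have d20 : 0 < d / 2 by rewrite divr_gt0.
have /choice[v vP] : forall w, exists v, F v /\ `|f (u w) - v| < d / 2.
  move=> w; have [z [Fz]] := AF _ (uA w) _ (nbhsx_ballx (f (u w)) _ d20).
  by rewrite -ball_normE => fz; exists z.
have vsep w w' : w != w' -> d < `|v w - v w'|.
  move=> /usep; rewrite -/d => h; have h1 := (vP w).2; have h2 := (vP w').2.
  have : `|f (u w) - f (u w')| <= `|f (u w) - v w| + `|v w - v w'| + `|f (u w') - v w'|.
    rewrite -[X in `|X|](subrKA (v w)); apply: (le_trans (ler_normD _ _)).
    rewrite -[leRHS]addrA lerD2l (distrC (f (u w'))) -[X in `|X| <= _](subrKA (v w')).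
    exact: ler_normD.
  by lra.
have md : d < m.+1%:R^-1.
  rewrite /d ltf_pV2 ?posrE ?exprn_gt0// -natrX ltr_nat.
  by rewrite (ltn_trans (ltnSn m.+1))// ltn_expl.
exists d; first by rewrite d0.
have lnK : 0 < ln K%:R :> R by rewrite ln_gt0// ltr1n.
have lnd : - ln d = ln K%:R * m.+2%:R.
  by rewrite /d lnV ?posrE ?exprn_gt0// opprK lnXn// -(mulr_natr (ln _)).
apply: (@lne_div_ge _ _ #|{: {ffun 'I_n -> 'I_(K ^ m.+1)}}|%:R).
- by rewrite lnd mulr_gt0.
- by rewrite ltr0n card_ffun !card_ord !expn_gt0 (ltn_trans _ K2).
- by apply: (cover_number_ge (u := v)) => // w; exact: (vP w).1.
rewrite lnd card_ffun !card_ord -expnM natrX lnXn// -(mulr_natr (ln _)) natrM.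
rewrite le_eqVlt; apply/orP; left; apply/eqP; field.
by rewrite gt_eqF.
Qed.

End many_points.

Section packing.
Variables (R : realType) (X : metricType R) (n : nat).
Hypothesis compactX : compact [set: X].

Lemma dimP_le_upper_dimB (F : set 'rV[R]_n) : bounded_set F ->
  (dimP F <= upper_dimB F)%E.
Proof.
move=> bF; apply: (@le_trans _ _ (ereal_sup (range (fun _ : nat => upper_dimB F)))).
  by apply: ereal_inf_lbound; exists (fun=> F) => //; split => // x Fx; exists 0%N.
by apply: ge_ereal_sup => _ [i _ <-].
Qed.

(** By Baire's theorem the closure of some piece contains the image of a relative ball of [C], hence
    separated families at arbitrarily fine scales. *)
Lemma dimP_ge (C : set X) (s : nat -> seq X) (f : X -> 'rV[R]_n) :
  closed C -> C !=set0 -> continuous f ->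
  (forall m y, C y -> exists p, [/\ p \in s m, C p & mdist p y < m.+1%:R^-1]) ->
  (forall m p, p \in s m -> C p ->
    many_points m (C `&` [set y | mdist p y < m.+1%:R^-1]) f) ->
  (n%:R%:E <= dimP (range f))%E.
Proof.
move=> clC C0 cf sC fs; apply: le_ereal_inf_tmp => _ [F [_ fF] <-].
have [||i [x [r [Cx r0 xF]]]] :=
    @compact_Baire R X compactX C (fun i => f @^-1` closure (F i)) clC C0.
- by move=> i; apply: closed_comp => [x _|]; [exact: cf|exact: closed_closure].
- move=> x _; have [|i _ Fi] := fF (f x); first by exists x.
  by exists i => //; exact: subset_closure.
apply: (@le_trans _ _ (upper_dimB (F i))); last first.
  by apply: ereal_sup_ubound; exists i.
apply: limf_esup_ge => V e /right0_nbhsP[c c0 cV] e0.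
(* The summands make the ball about the net point fit into that of radius [r], the scale smaller
   than [c], and the loss [n / (m + 2)] at most [e]. *)
pose b : R := 2 / r + c^-1 + n%:R / e.
have b1 : 0 <= 2 / r by rewrite divr_ge0// ltW.
have b2 : 0 <= c^-1 by rewrite invr_ge0 ltW.
have b3 : 0 <= n%:R / e by rewrite divr_ge0// ltW.
have b0 : 0 <= b by rewrite !addr_ge0.
pose m := Num.trunc b.
have mb : b < m.+1%:R by have /andP[] := truncn_itv b0.
have m0 : 0 < m.+1%:R :> R by rewrite ltr0n.
have mr : 2 * m.+1%:R^-1 < r.
  by rewrite ltr_pdivrMr// mulrC -ltr_pdivrMr//; apply: le_lt_trans mb; rewrite /b; lra.
have [p [ps Cp px]] := sC m x Cx.
have [|d /andP[d0 dm] fd] := upper_dimB_closure_many_points (F := F i) _ (fs m p ps Cp).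
  move=> y [Cy /= py]; apply: xF => //.
  move: (metric_triangle x p y) py px mr; rewrite (metric_sym x p).
  by move: (m.+1%:R^-1) => v; lra.
exists d.
  apply: cV; rewrite d0 (lt_trans dm)// invf_plt//.
  by apply: le_lt_trans mb; rewrite /b; lra.
apply: le_trans fd; rewrite lee_fin ler_pdivlMr//.
have ne : n%:R <= e * m.+1%:R.
  by rewrite mulrC -ler_pdivrMr// ltW//; apply: le_lt_trans mb; rewrite /b; lra.
by rewrite -(natr1 m.+1); move: ne; move: (m.+1%:R) => v; nra.
Qed.

End packing.

(** * Dimensions of the generic image *)

Lemma covering_dim_leW (T : topologicalType) (i j : nat) : (i <= j)%N ->
  covering_dim_le T i -> covering_dim_le T j.
Proof.
move=> ij Ti p U oU Ucov; have [q [V [oV Vcov VU Vi]]] := Ti p U oU Ucov.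
by exists q, V; split => // x; rewrite (leq_trans (Vi x)).
Qed.

(** Infinite dimension is absorbed by [k = n]; the last two clauses serve the upper and the lower
    bounds. *)
Lemma min_dimTP (R : realType) (T : topologicalType) (n : nat) :
  exists k : nat, [/\ (k <= n)%N, Order.min n%:R%:E (dimT T R) = k%:R%:E,
    k = n \/ covering_dim_le T k &
    forall j, (j < k)%N -> ~ covering_dim_le T j].
Proof.
have [[j0 [j0n Tj0]]|noj] :=
    pselect (exists j, (j < n)%N /\ covering_dim_le T j); last first.
  exists n; split => //; [|by left|by move=> j jn Tj; apply: noj; exists j].
  rewrite min_l//; apply: le_ereal_inf_tmp => _ [j Tj <-].
  by rewrite lee_fin ler_nat leqNgt; apply/negP => jn; apply: noj; exists j.
have exT : exists j, `[< covering_dim_le T j >] by exists j0; exact/asboolP.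
have [k /asboolP Tk kmin] := ex_minnP exT.
have kn : (k <= n)%N by rewrite (leq_trans (kmin _ (asboolT Tj0)))// ltnW.
exists k; split => //; [|by right|]; last first.
  by move=> j jk /asboolP/kmin; rewrite leqNgt jk.
have -> : dimT T R = k%:R%:E.
  apply/eqP; rewrite eq_le; apply/andP; split.
    by apply: ereal_inf_lbound; exists k.
  by apply: le_ereal_inf_tmp => _ [j Tj <-]; rewrite lee_fin ler_nat kmin//; exact/asboolP.
by rewrite min_r// lee_fin ler_nat.
Qed.

Theorem theorem2p1 (R : realType) (X : metricType R) (n : nat)
    (n_gt0 : (0 < n)%N) (compactX : compact [set: X])
    (uncountableX : ~ countable [set: X]) :
  residual [set f : Cn R X n |
    [/\ dimT (range f) R = Order.min n%:R%:E (dimT X R),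
        dimH (range f) = Order.min n%:R%:E (dimT X R),
        lower_dimB (range f) = Order.min n%:R%:E (dimT X R),
        dimP (range f) = n%:R%:E &
        upper_dimB (range f) = n%:R%:E]].
Proof.
have X0 : [set: X] !=set0.
  by apply/set0P; apply/eqP => X0; apply: uncountableX; rewrite X0.
have [k [kn -> kdim kmin]] := min_dimTP R X n.
pose C := @condensation R X.
have clC : closed C by exact: closed_condensation.
have C0 : C !=set0.
  apply/set0P/eqP => CE; apply: (infinite_condensation compactX uncountableX).
  by rewrite -/C CE setI0; exact: finite_set0.
have [x0 _] := X0.
(* To have centres in [C], points outside the closed set [C] get neighbourhoods that miss it. *)
have /choice[s sP] : forall m : nat, exists s : seq X, forall y, C y ->
    exists p, [/\ p \in s, C p & mdist p y < m.+1%:R^-1].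
  move=> m.
  have [|s sP] := finite_net compactX (U := fun p => [set y |
      C p /\ mdist p y < m.+1%:R^-1 \/ ~ C y]).
    move=> p; have [Cp|nCp] := pselect (C p).
      apply: filterS (nbhs_mdist p (_ : 0 < m.+1%:R^-1)) => [y py|]; first by left.
      by rewrite invr_gt0.
    apply: (@filterS _ _ _ (~` C)); first by move=> y; right.
    by apply: open_nbhs_nbhs; split => //; exact: closed_openC.
  by exists s => y Cy; have [p ps [[Cp py]|//]] := sP y; exists p.
(* This form asks nothing when [k = 0]. *)
pose S (f : X -> 'rV[R]_n) :=
  forall j (jn : (j.+1 <= n)%N), k = j.+1 -> stable_value jn f.
have dS : dense_interior S.
  rewrite /S; clear S; case: k kn kdim kmin => [|j] jn kdim kmin.
    by apply: dense_interiorS (@dense_interior_setT _ _ _).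
  apply: dense_interiorS (dense_interior_stable_value compactX x0 jn (kmin j (ltnSn j))).
  by move=> f fj j' jn' [jj']; subst j'; rewrite (bool_irrelevance jn' jn).
pose O m (f : X -> 'rV[R]_n) := [/\ S f, small_cover k m (range f) &
  forall p, p \in s m -> C p ->
    many_points m (C `&` [set y | mdist p y < m.+1%:R^-1]) f].
apply: (@residual_dense_interior _ _ _ _ O) => // [m|f fO].
  apply: (@dense_interiorS _ _ _ ((S `&` [set f | small_cover k m (range f)]) `&`
    [set f | forall p, p \in s m -> C p ->
      many_points m (C `&` [set y | mdist p y < m.+1%:R^-1]) f])).
    by move=> f [[]].
  apply: dense_interiorI.
    exact: (dense_interiorI dS (dense_interior_small_cover m compactX X0 n_gt0 kdim)).
  apply: dense_interior_seq => p; have [Cp|nCp] := pselect (C p); last first.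
    by apply: dense_interiorS (@dense_interior_setT _ _ _) => f _ /nCp.
  apply: (@dense_interiorS _ _ _
    (many_points m (C `&` [set y | mdist p y < m.+1%:R^-1]))) => [f fm _ //|].
  (* Balls about a condensation point are uncountable, so they meet [C] in infinite sets. *)
  apply: (@dense_interior_many_points _ _ _ _ _ p) => r r0.
  have e0 : 0 < Num.min r m.+1%:R^-1 by rewrite lt_min r0 invr_gt0 ltr0n.
  move=> fin; apply: (infinite_condensation compactX (Cp _ e0)).
  apply: sub_finite_set fin => y [/=]; rewrite lt_min => /andP[yr ym] Cy.
  by split.
have cf : continuous f := @cts_fun _ _ f.
have fX0 : range f !=set0 by exists (f x0), x0.
have [M _ fM] := compact_range_bounded compactX cf.
have lower : (lower_dimB (range f) <= k%:R%:E)%E.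
  by apply: lower_dimB_le => // m; have [] := fO m.
have dimHlow := dimH_le_lower_dimB fX0.
have stab j : (j < k)%N -> ~ covering_dim_le (range f) j.
  move=> jk; have kk : k = k.-1.+1 by rewrite prednK// (leq_ltn_trans _ jk).
  have kn' : (k.-1.+1 <= n)%N by rewrite -kk.
  have [Sf _ _] := fO 0%N; rewrite kk ltnS in jk => /(covering_dim_leW jk).
  exact: (stable_value_range_dim compactX x0 cf (Sf _ kn' kk)).
(* A smaller Hausdorff dimension would, by Szpilrajn's inequality, bound the covering dimension by
   [k.-1], against [stab]. *)
have leH : (k%:R%:E <= dimH (range f))%E.
  have [->|k0] := posnP k; first exact: dimH_ge0.
  rewrite leNgt -(prednK k0).
  apply/negP => /(covering_dim_le_Hausdorff compactX X0 cf).
  by apply: stab; rewrite prednK.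
have dimHE : dimH (range f) = k%:R%:E.
  by apply/eqP; rewrite eq_le leH (le_trans dimHlow).
have upper : (upper_dimB (range f) <= n%:R%:E)%E.
  apply: upper_dimB_le => //; apply: (@grid_covered_bounded _ _ _ M).
  by move=> _ [x _ <-].
have bounded_f : bounded_set (range f).
  exists M; split; first exact: num_real.
  by move=> N MN _ [x _ <-]; rewrite /= (le_trans (fM x))// ltW.
have packP : (n%:R%:E <= dimP (range f))%E.
  by apply: (dimP_ge compactX clC C0 cf sP) => m; have [] := fO m.
have packB := dimP_le_upper_dimB bounded_f.
split.
- apply/eqP; rewrite eq_le; apply/andP; split.
    apply: ereal_inf_lbound; exists k => //.
    apply: (covering_dim_le_Hausdorff compactX X0 cf).
    by rewrite dimHE lte_fin ltr_nat.
  apply: le_ereal_inf_tmp => _ [j fj <-]; rewrite lee_fin ler_nat leqNgt.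
  by apply/negP => /stab.
- exact: dimHE.
- by apply/eqP; rewrite eq_le lower -dimHE.
- by apply/eqP; rewrite eq_le packP (le_trans packB).
- by apply/eqP; rewrite eq_le upper (le_trans packP).
Qed.
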